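(* Let $d\ge 2$ and $1\le j,k\le d-1$. Let $\mu$ be the measure on $\mathbb{R}^d$ which is the sum of the $k$-dimensional Lebesgue (area) measure on $[0,1]^k\times\{0\}^{d-k}$ and the $j$-dimensional Lebesgue (area) measure on $\{0\}^{d-j}\times[0,1]^j$. Then $L^2(\mu)$ admits a Fourier frame.
   Context: For $\lambda\in\mathbb{R}^d$ let $e_\lambda(x)=e^{2\pi i\langle\lambda,x\rangle}$. For a positive finite Borel measure $\mu$ on $\mathbb{R}^d$ and a countable set $\Lambda\subset\mathbb{R}^d$, the system $E(\Lambda)=\{e_\lambda\}_{\lambda\in\Lambda}$ is a Fourier frame for $L^2(\mu)$ if there are constants $0<A,B<\infty$ with $A\|f\|^2_{L^2(\mu)}\le\sum_{\lambda\in\Lambda}|\langle f,e_\lambda\rangle_{L^2(\mu)}|^2\le B\|f\|^2_{L^2(\mu)}$ for all $f\in L^2(\mu)$. ''$L^2(\mu)$ admits a Fourier frame'' means such a $\Lambda$ exists. *)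

(* Defs.v *)
From HB Require Import structures.
From mathcomp Require Import all_boot all_order all_algebra.
From mathcomp Require Import all_classical all_reals all_analysis.
From mathcomp Require Import complex.

Unset Strict Implicit.
Unset Printing Implicit Defensive.

Import Order.TTheory GRing.Theory Num.Theory.
Import numFieldNormedType.Exports.

Local Open Scope classical_set_scope.
Local Open Scope ring_scope.

(* R^n is modelled as n.-tuple R, with the product (= Borel) sigma-algebra
   provided by MathComp-Analysis (measurable_structure.v, measurable_tuple). *)

Section Defs.
Variable R : realType.

(* n-dimensional Lebesgue measure on the Borel sets of R^n, built as the
   iterated product measure  lebesgue \x lebesgue \x ... \x lebesgue
   (transported along the bijection (x, t) |-> x :: t). *)
Fixpoint lebesgue_n (n : nat) : set (n.-tuple R) -> \bar R :=
  match n return set (n.-tuple R) -> \bar R with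
  | 0%N => fun A => \d_([tuple] : 0.-tuple R) A
  | n'.+1 => fun A =>
      ((@lebesgue_measure R) \x (lebesgue_n n'))%E
        [set p : R * n'.-tuple R | [tuple of p.1 :: p.2] \in A]
  end.

(* the unit cube [0,1]^n *)
Definition unit_cube (n : nat) : set (n.-tuple R) :=
  [set x | forall i : 'I_n, 0 <= tnth x i <= 1].

(* n-dimensional Lebesgue measure restricted to [0,1]^n *)
Definition cube_measure (n : nat) : set (n.-tuple R) -> \bar R :=
  fun A => lebesgue_n n (A `&` unit_cube n).

(* [0,1]^k x {0}^(d-k) : x |-> (x_1, ..., x_k, 0, ..., 0) *)
Definition embed_first (d k : nat) (x : k.-tuple R) : d.-tuple R :=
  [tuple (if (i < k)%N then nth 0 x i else 0) | i < d].

(* {0}^(d-j) x [0,1]^j : y |-> (0, ..., 0, y_1, ..., y_j) *)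
Definition embed_last (d j : nat) (y : j.-tuple R) : d.-tuple R :=
  [tuple (if (d - j <= i)%N then nth 0 y (i - (d - j)) else 0) | i < d].

(* mu = (k-dim area measure on [0,1]^k x {0}^(d-k))
        + (j-dim area measure on {0}^(d-j) x [0,1]^j),
   each being the pushforward of the restricted Lebesgue measure
   along the corresponding embedding. *)
Definition mu_kj (d k j : nat) : set (d.-tuple R) -> \bar R :=
  fun A => (pushforward (cube_measure k) (embed_first d k) A
            + pushforward (cube_measure j) (embed_last d j) A)%E.

(* Euclidean inner product on R^d *)
Definition dotR (d : nat) (u v : d.-tuple R) : R :=
  \sum_(i < d) tnth u i * tnth v i.

(* e_lambda(x) = exp(2 pi i <lambda, x>) = cos(2 pi <lambda,x>) + i sin(2 pi <lambda,x>) *)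
Definition expo (d : nat) (lam x : d.-tuple R) : R[i] :=
  ((cos (2 * pi * dotR d lam x))%:C + 'i * (sin (2 * pi * dotR d lam x))%:C)%C.

Definition sqnormC (z : R[i]) : R := complex.Re z ^+ 2 + complex.Im z ^+ 2.

(* Membership in L^2(mu): Borel measurable with finite square integral. *)
Definition L2 (d : nat) (mu : set (d.-tuple R) -> \bar R)
    (f : d.-tuple R -> R[i]) : Prop :=
  measurable_fun setT (fun x => complex.Re (f x)) /\
  measurable_fun setT (fun x => complex.Im (f x)) /\
  (\int[mu]_x (sqnormC (f x))%:E < +oo)%E.

Definition L2norm2 (d : nat) (mu : set (d.-tuple R) -> \bar R)
    (f : d.-tuple R -> R[i]) : \bar R :=
  (\int[mu]_x (sqnormC (f x))%:E)%E.

(* complex Lebesgue integral: integral of real part + i integral of imaginary part *)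
Definition Cintegral (d : nat) (mu : set (d.-tuple R) -> \bar R)
    (g : d.-tuple R -> R[i]) : R[i] :=
  ((fine (\int[mu]_x (complex.Re (g x))%:E))%:C
   + 'i * (fine (\int[mu]_x (complex.Im (g x))%:E))%:C)%C.

(* <f, g>_{L^2(mu)} = int f conj(g) dmu *)
Definition L2inner (d : nat) (mu : set (d.-tuple R) -> \bar R)
    (f g : d.-tuple R -> R[i]) : R[i] :=
  Cintegral d mu (fun x => (f x * (g x)^*)%C).

(* E(Lambda) is a Fourier frame for L^2(mu) *)
Definition fourier_frame (d : nat) (mu : set (d.-tuple R) -> \bar R)
    (Lam : set (d.-tuple R)) : Prop :=
  exists A B : R, 0 < A /\ 0 < B /\
    forall f, L2 d mu f ->
      ((A%:E * L2norm2 d mu f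
        <= \esum_(lam in Lam) (sqnormC (L2inner d mu f (expo d lam)))%:E)
      /\ (\esum_(lam in Lam) (sqnormC (L2inner d mu f (expo d lam)))%:E
          <= B%:E * L2norm2 d mu f))%E.

(* L^2(mu) admits a Fourier frame *)
Definition admits_fourier_frame (d : nat) (mu : set (d.-tuple R) -> \bar R) : Prop :=
  exists Lam : set (d.-tuple R), countable Lam /\ fourier_frame d mu Lam.

End Defs.

(* Main.v *)
Require Import Defs.
From HB Require Import structures.
From mathcomp Require Import all_boot all_order all_algebra.
From mathcomp Require Import all_classical all_reals all_analysis.
From mathcomp Require Import complex.
From mathcomp Require Import measurable_realfun zify ring lra.

(** For exponentials e_m, e_n with integer frequencies, a function on the union
    of the two cubes has coefficients c_m (m in Z^k) on the first cube and d_n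
    (n in Z^j) on the second, and its inner product with e_l for l in Z^d is
    c_m + d_n, where m and n are the first k and the last j entries of l. By
    Parseval on each cube the frame inequality becomes one in l^2: the squares
    |c_m + d_n|^2, summed over the chosen pairs (m, n), must be comparable to
    |c|^2 + |d|^2. Choose maps p : Z^k -> Z^j and r : Z^j -> Z^k which are
    exactly four-to-one, compatible with the entries shared by m and n, and take
    the pairs (m, p m) and (r n, n). Since |z + w|^2 >= |w|^2 / 2 - |z|^2 and
    |d o p|^2 = 4 |d|^2, the first family gives at least 2 |d|^2 - |c|^2, the
    second at least 2 |c|^2 - |d|^2, and these add up to |c|^2 + |d|^2. (The
    pairs are the edges of a graph in which every vertex has four children; the
    estimate is its nonamenability.)

    Parseval is proved for the real orthonormal system
    cas(2 pi <m, x>) = cos + sin, whose span is an algebra. The sets whose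
    indicator is an almost everywhere limit of elements of the span with values
    in [0, 1] form a pi-system containing the half-spaces {x_i > a}, and the
    sets whose indicator lies in the closed span form a lambda-system. *)

Import Order.TTheory GRing.Theory Num.Theory.
Import numFieldNormedType.Exports.

Local Open Scope classical_set_scope.
Local Open Scope ring_scope.

(** * The unit cube as a probability space *)

Section integral_set_function.
Import HBNNSimple.

(* Integrals in [L2] and [L2inner] are taken against a bare set function, on which
   no canonical measure structure can be inferred. *)
Lemma eq_integral_set_function (d : measure_display) (T : measurableType d)
    (R : realType) (m1 m2 : set T -> \bar R) :
  (forall A, measurable A -> m1 A = m2 A) ->
  forall D (f : T -> \bar R), integral m1 D f = integral m2 D f.
Proof.
move=> m12 D f; rewrite /integral.
suff E (h : {nnsfun T >-> R}) : sintegral m1 h = sintegral m2 h.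
  congr (ereal_sup _ - ereal_sup _)%E; apply/seteqP; split => _ [h hf <-];
  by exists h => //; rewrite E.
rewrite /sintegral; apply: eq_fsbigr => x _; congr (_ * _)%E.
by apply: m12; exact: measurable_funPTI.
Qed.

End integral_set_function.

Section cube.
Context {R : realType}.

(* [lebesgue_measure] lives on [measurableTypeR R], which has the same measurable
   sets as [R] but a different display. *)
Definition tcons n (p : measurableTypeR R * n.-tuple R) : n.+1.-tuple R :=
  [tuple of p.1 :: p.2].

Lemma measurable_tcons n : measurable_fun setT (@tcons n).
Proof.
apply: measurable_cons; last exact: measurable_snd.
exact: (@measurable_fst _ _ (measurableTypeR R) (n.-tuple R)).
Qed.

Lemma product_probability_setT d1 d2 (T1 : measurableType d1) (T2 : measurableType d2)
  (P : probability T1 R) (Q : probability T2 R) : (P \x Q)%E setT = 1%:E.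
Proof.
rewrite -setXTT product_measure1E//.
set a := (X in (X * _)%E); set b := (X in (_ * X)%E).
have -> : a = 1%:E by exact: probability_setT.
have -> : b = 1%:E by exact: probability_setT.
by rewrite mule1. Qed.

(** The structure of a probability comes from [mnormalize], which divides by the total mass, here 1;
    the Dirac measure is only its default value for mass zero or infinity. *)
Lemma probability_of_measure d (T : measurableType d) (m : {measure set T -> \bar R}) :
  m setT = 1%:E -> exists Q : probability T R, forall A, Q A = m A.
Proof.
move=> mT.
exists (mnormalize m (dirac (point : T))) => A.
transitivity (m A * (fine 1%:E)^-1%:E)%E; last by rewrite /= invr1 mule1.
transitivity (mnormalize m (dirac (point : T)) A) => //.
by rewrite /mnormalize mT eqe oner_eq0.
Qed.

Definition uniform01 : probability (measurableTypeR R) R := uniform_prob (@ltr01 R).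

Lemma cube_probability_succ n (P : probability (n.-tuple R) R) :
  exists Q : probability (n.+1.-tuple R) R,
    forall A, Q A = pushforward (uniform01 \x P)%E (@tcons n) A.
Proof.
pose f : {mfun _ >-> _} := mfun_Sub (mem_set (@measurable_tcons n)).
apply: (probability_of_measure _ _ (pushforward (uniform01 \x P)%E f)).
exact: product_probability_setT.
Qed.

(** The product [\x] unfolds to the integral of the sizes of the sections, so [lebesgue_n n] may
    remain a bare set function here. *)
Lemma lebesgue_nS n A :
  lebesgue_n R n.+1 A =
  (\int[lebesgue_measure]_x lebesgue_n R n [set y | A (tcons n (x, y))])%E.
Proof.
rewrite /= /product_measure1; apply: eq_integral => x _ /=; congr lebesgue_n.
apply/seteqP; split => y; rewrite /xsection/= ?inE => Ay.
  by have /set_mem := Ay.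
exact: mem_set.
Qed.

Lemma lebesgue_n0 n : lebesgue_n R n set0 = 0%E.
Proof.
elim: n => [|n IH]; first by rewrite /= dirac0.
by rewrite lebesgue_nS integral0_eq// => x _; rewrite -[RHS]IH.
Qed.

Lemma unit_cube_tcons n x (y : n.-tuple R) :
  unit_cube R n.+1 (tcons n (x, y)) <-> 0 <= x <= 1 /\ unit_cube R n y.
Proof.
split=> [xy|[x01 y01] i].
  split; first by have := xy ord0; rewrite (tnth_nth 0).
  by move=> i; have := xy (lift ord0 i); rewrite !(tnth_nth 0).
case: (unliftP ord0 i) => [j ->|->]; last by rewrite (tnth_nth 0).
by have := y01 j; rewrite !(tnth_nth 0).
Qed.

(** Both sides integrate the size of the section at [x]: on the left over [0, 1] only, on the right
    over the whole line, where the cube has empty sections outside [0, 1]. *)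
Lemma cube_measure_succ n (P : probability (n.-tuple R) R) :
  (forall A, measurable A -> P A = cube_measure R n A) ->
  forall A, measurable A ->
    pushforward (uniform01 \x P)%E (@tcons n) A = cube_measure R n.+1 A.
Proof.
move=> PE A mA.
have mB : measurable (@tcons n @^-1` A).
  by rewrite -[X in measurable X]setTI; exact: measurable_tcons.
rewrite /pushforward/= /product_measure1 integral_uniform//; first last.
  exact: measurable_fun_xsection.
rewrite subr0 invr1 mul1e integral_mkcond/= /cube_measure lebesgue_nS.
apply: eq_integral => x _; rewrite patchE/=.
case: ifPn => xI.
  rewrite PE; last exact: measurable_xsection.
  rewrite /cube_measure; congr lebesgue_n; apply/seteqP; split=> y.
    move=> [/set_mem Axy y01]; split; first exact: Axy.
    by apply/unit_cube_tcons; split => //; move: xI; rewrite inE/= in_itv.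
  by move=> [Axy /unit_cube_tcons[_ y01]]; split => //; exact: mem_set.
rewrite -[LHS](lebesgue_n0 n); congr lebesgue_n; apply/seteqP; split=> // y.
by move=> [_ /unit_cube_tcons[x01 _]]; case/negP: xI; rewrite inE/= in_itv/= x01.
Qed.

Definition zdot n (m : n.-tuple int) (x : n.-tuple R) : R :=
  \sum_(i < n) (tnth m i)%:~R * tnth x i.

Lemma zdot_tcons n (z : int) (m : n.-tuple int) x y :
  zdot n.+1 [tuple of z :: m] (tcons n (x, y)) = z%:~R * x + zdot n m y.
Proof.
rewrite /zdot big_ord_recl !(tnth_nth 0)/=; congr (_ + _).
by apply: eq_bigr => i _; rewrite !(tnth_nth 0).
Qed.

Lemma measurable_zdot n m : measurable_fun setT (zdot n m).
Proof.
apply: measurable_sum => i; apply: measurable_funM => //.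
exact: measurable_tnth.
Qed.

Lemma sin_periodz (z : int) (t : R) : sin (2 * pi * z%:~R + t) = sin t.
Proof.
have P (n : nat) (s : R) : sin (2 * pi * n%:R + s) = sin s.
  rewrite -[RHS](periodicn (@sinD2pi R) n); congr sin.
  by rewrite addrC -[in RHS](mulr_natl pi 2) [in LHS]mulr_natr.
case: z => n; first exact: P.
rewrite NegzE mulrNz mulrN -[LHS](P n.+1) addrA subrr add0r //.
Qed.

Lemma integral_uniform01_cos (z : int) (t : R) :
  (\int[uniform01]_x (cos (2 * pi * z%:~R * x + t))%:E = ((z == 0)%:R * cos t)%:E)%E.
Proof.
have [->|z0] := eqVneq z 0.
  under eq_integral do rewrite mulr0 mul0r add0r.
  rewrite integral_cst//= probability_setT mule1.
  by rewrite mul1r.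
pose w : R := 2 * pi * z%:~R.
have w0 : w != 0 by rewrite !mulf_neq0 ?intr_eq0// gt_eqF// pi_gt0.
have cc : continuous (fun x : R => cos (w * x + t)).
  move=> x; apply: continuous_comp; last exact: continuous_cos.
  apply: continuousD; last exact: cvg_cst.
  by apply: continuousM; [exact: cvg_cst|exact: cvg_id].
have mc : measurable_fun setT (fun x : R => cos (w * x + t)).
  exact: continuous_measurable_fun.
(* Adding 1 makes the integrand nonnegative, as [integral_uniform] demands. The antiderivative [F]
   grows by exactly 1 over [0, 1], its sine term having period 1. *)
have H : (\int[uniform01]_x (1 + cos (w * x + t))%:E = 1%:E)%E.
  rewrite integral_uniform; first last.
  - by move=> x; rewrite lee_fin -lerBlDl sub0r cos_geN1.
  - by apply/measurable_EFinP; apply: measurable_funD.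
  rewrite subr0 invr1 mul1e.
  pose F x : R := x + w^-1 * sin (w * x + t).
  have dF (x : R) : is_derive x (1 : R) F (1 + cos (w * x + t)).
    by apply: is_derive_eq; rewrite /GRing.scale/= addr0 mulr1 mulrCA mulVf// mulr1.
  have cF : continuous F.
    by move=> x; apply/differentiable_continuous/derivable1_diffP; case: (dF x).
  rewrite (@continuous_FTC2 _ _ F)//.
  - by rewrite -EFinB /F mulr1 mulr0 !add0r /w sin_periodz addrK.
  - by apply: continuous_subspaceT => x; apply: continuousD; [exact: cvg_cst|exact: cc].
  - split; first (move=> x _); first by case: (dF x).
    + exact/cvg_at_right_filter/cF.
    + exact/cvg_at_left_filter/cF.
  - by move=> x _; rewrite derive1E; apply: derive_val.
have ic : uniform01.-integrable setT (EFin \o (fun x : R => cos (w * x + t))).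
  apply: measurable_bounded_integrable => //.
    exact: (le_lt_trans (probability_le1 uniform01 measurableT) (ltry 1)).
  exists 1; split => // M M1 x _ /=.
  by rewrite (le_trans (cos_max _))// ltW.
have If := integrable_fin_num measurableT ic.
have : (1%:E + \int[uniform01]_x (cos (w * x + t))%:E = 1%:E)%E.
  rewrite -[RHS]H; under [RHS]eq_integral do rewrite EFinD.
  rewrite integralD//=; last exact: finite_measure_integrable_cst.
  by rewrite integral_cst//= -[in LHS](mule1 1%:E); congr (_ * _ + _)%E;
    rewrite -[LHS](@probability_setT _ _ _ uniform01).
rewrite mul0r; rewrite /= in If; rewrite -(fineK If) -EFinD => -[h].
by congr EFin; apply: (addrI 1); rewrite h addr0.
Qed.

Lemma measurable_cos_zdot n (m : n.-tuple int) (t : R) :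
  measurable_fun setT (fun x => cos (2 * pi * zdot n m x + t)).
Proof.
  have mc : measurable_fun setT (@cos R).
    by apply: continuous_measurable_fun; exact: continuous_cos.
  apply: (measurableT_comp mc); apply: measurable_funD => //.
  apply: measurable_funM => //.
  exact: measurable_zdot.
Qed.

(** By Fubini the first coordinate is integrated out first, the others being absorbed into the
    phase; this is why the phase [t] is arbitrary. *)
Lemma integral_uniform01X_cos n (P : probability (n.-tuple R) R) (t : R) (z : int) m :
  (forall t, \int[P]_x (cos (2 * pi * zdot n m x + t))%:E =
     ((all (eq_op 0) m)%:R * cos t)%:E)%E ->
  (\int[pushforward (uniform01 \x P)%E (@tcons n)]_x
    (cos (2 * pi * zdot n.+1 [tuple of z :: m] x + t))%:E =
     ((all (eq_op 0) (z :: m))%:R * cos t)%:E)%E.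
Proof.
move=> IH.
pose g : n.+1.-tuple R -> \bar R :=
  EFin \o (fun x => cos (2 * pi * zdot n.+1 [tuple of z :: m] x + t)).
have mg : measurable_fun setT g by apply/measurable_EFinP; exact: measurable_cos_zdot.
have ig : (uniform01 \x P)%E.-integrable (tcons n @^-1` setT) (g \o tcons n).
  rewrite preimage_setT; apply: measurable_bounded_integrable => //.
  - by rewrite [X in (X < _)%E]product_probability_setT ltry.
  - exact: (measurableT_comp (measurable_cos_zdot _ _ _) (measurable_tcons n)).
  by exists 1; split => // M M1 x _ /=; rewrite (le_trans (cos_max _))// ltW.
rewrite (integral_pushforward (measurable_tcons n) mg ig)//.
move: ig; rewrite preimage_setT => ig.
rewrite -(integral21_prod_meas1 ig)/=.
transitivity (\int[P]_y ((z == 0)%:R * cos (2 * pi * zdot n m y + t))%:E)%E.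
  apply: eq_integral => y _; rewrite -[RHS]integral_uniform01_cos /fubini_G.
  apply: eq_integral => x _; rewrite /g/= zdot_tcons; congr (cos _)%:E; ring.
under eq_integral do rewrite EFinM.
rewrite integralZl//; last first.
  apply: measurable_bounded_integrable => //.
  - exact: (le_lt_trans (probability_le1 P measurableT) (ltry 1)).
  - exact: measurable_cos_zdot.
  by exists 1; split => // M M1 x _ /=; rewrite (le_trans (cos_max _))// ltW.
rewrite IH -EFinM mulrA; congr (_ * _)%:E.
by rewrite /= eq_sym; case: eqVneq => _; rewrite ?mul1r ?mul0r.
Qed.

(** The three properties are all that later parts use of [P]: the first links it to [mu_kj], the
    second provides null sets, the third yields orthogonality. *)
Theorem cube_probability n : exists P : probability (n.-tuple R) R,
  [/\ forall A, measurable A -> P A = cube_measure R n A,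
      forall i A, measurable A -> P ((fun x => tnth x i) @^-1` A) = uniform01 A &
      forall (m : n.-tuple int) t,
        (\int[P]_x (cos (2 * pi * zdot n m x + t))%:E =
          ((all (eq_op 0) m)%:R * cos t)%:E)%E].
Proof.
elim: n => [|n [P [PE Pm Pc]]].
  exists (dirac ([tuple] : 0.-tuple R)); split=> [A mA|[]//|m t].
    rewrite /cube_measure /= (_ : unit_cube R 0 = setT) ?setIT//.
    by apply/seteqP; split=> // x _ [].
  rewrite integral_dirac//; last first.
    by apply/measurable_EFinP; exact: measurable_cos_zdot.
  rewrite [X in (X * _)%E]diracE in_setT mul1e /zdot big_ord0 mulr0 add0r.
  by rewrite (tuple0 m)/= mul1r.
have [Q QE] := cube_probability_succ n P; exists Q; split=> [A mA|i A mA|m t].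
- by rewrite QE; exact: cube_measure_succ.
- rewrite QE /pushforward; case: (unliftP ord0 i) => [j ->|->].
    have -> : tcons n @^-1` ((fun x => tnth x (lift ord0 j)) @^-1` A) =
        setT `*` ((fun x => tnth x j) @^-1` A).
      by apply/seteqP; split=> -[x y]/=; rewrite !(tnth_nth 0)//=; case.
    rewrite product_measure1E//; last first.
      by rewrite -[X in measurable X]setTI; exact: measurable_tnth.
    by rewrite -[RHS]mul1e; congr (_ * _)%E; [exact: probability_setT|exact: Pm].
  have -> : tcons n @^-1` ((fun x => tnth x ord0) @^-1` A) = A `*` setT.
    by apply/seteqP; split=> -[x y]/=; rewrite !(tnth_nth 0)//=; case.
  rewrite product_measure1E// -[RHS]mule1; congr (_ * _)%E.
  exact: probability_setT.
- rewrite (eq_integral_set_function _ _ _ _ _ (fun A _ => QE A)).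
  by rewrite (tuple_eta m); apply: integral_uniform01X_cos.
Qed.

End cube.

(** * Square integrable functions *)

Section square_integrable.
Context {d : measure_display} {T : measurableType d} {R : realType}.
Variable P : probability T R.
Implicit Types u v w : T -> R.

(** Everything is real-valued; a complex function enters as the pair of its real and imaginary
    parts. *)
Definition sqint u := measurable_fun setT u /\
  P.-integrable setT (EFin \o (fun x => u x ^+ 2)).

Definition ip u v : R := \int[P]_x (u x * v x).

Lemma bounded_integrable u (C : R) : measurable_fun setT u ->
  (forall x, `|u x| <= C) -> P.-integrable setT (EFin \o u).
Proof.
move=> mu uC; apply: measurable_bounded_integrable => //.
  exact: (le_lt_trans (probability_le1 P measurableT) (ltry 1)).
by exists C; split => [|M CM x _ /=]; rewrite ?num_real// (le_trans (uC x))// ltW.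
Qed.

Lemma sqint_bounded u (C : R) : measurable_fun setT u ->
  (forall x, `|u x| <= C) -> sqint u.
Proof.
move=> mu uC; split=> //; apply: (bounded_integrable _ (C ^+ 2)).
  exact: measurable_funX.
by move=> x; rewrite normrX; apply: lerXn2r; rewrite ?nnegrE// (le_trans _ (uC x)).
Qed.

(** The product is dominated by [u ^+ 2 + v ^+ 2]. *)
Lemma sqint_mul u v : sqint u -> sqint v ->
  P.-integrable setT (EFin \o (fun x => u x * v x)).
Proof.
move=> [mu iu] [mv iv].
have iuv := integrableD measurableT iu iv.
apply: (le_integrable measurableT _ _ iuv).
  by apply/measurable_EFinP; exact: measurable_funM.
move=> x _ /=; rewrite lee_fin [leRHS]ger0_norm ?addr_ge0 ?sqr_ge0//.
rewrite ler_norml; apply/andP; split; nra.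
Qed.

Lemma ipC u v : ip u v = ip v u.
Proof. by apply: eq_Rintegral => x _; rewrite mulrC. Qed.

Lemma sqintZ (c : R) u : sqint u -> sqint (fun x => c * u x).
Proof.
move=> [mu iu]; split; first exact: measurable_funM.
apply: eq_integrable (integrableZl measurableT (c ^+ 2) iu) => // x _.
by rewrite /= -EFinM exprMn.
Qed.

Lemma sqintD u v : sqint u -> sqint v -> sqint (fun x => u x + v x).
Proof.
move=> su sv; have [mu iu] := su; have [mv iv] := sv.
split; first exact: measurable_funD.
have i2 := integrableZl measurableT 2 (sqint_mul _ _ su sv).
apply: eq_integrable (integrableD measurableT (integrableD measurableT iu i2) iv) => //.
by move=> x _; rewrite /= -!EFinD sqrrD mulr_natl.
Qed.

Lemma sqintB u v : sqint u -> sqint v -> sqint (fun x => u x - v x).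
Proof.
move=> su sv; have := sqintD _ _ su (sqintZ (-1) _ sv).
by under [X in sqint X]eq_fun do rewrite mulN1r.
Qed.

Lemma sqint_sum (I : Type) (s : seq I) (f : I -> T -> R) :
  (forall i, sqint (f i)) -> sqint (fun x => \sum_(i <- s) f i x).
Proof.
move=> sf; elim: s => [|i s IH].
  by under eq_fun do rewrite big_nil; apply: (sqint_bounded _ 0) => // x; rewrite normr0.
by under eq_fun do rewrite big_cons; exact: sqintD.
Qed.

Lemma ipDr u v w : sqint u -> sqint v -> sqint w ->
  ip u (fun x => v x + w x) = ip u v + ip u w.
Proof.
move=> su sv sw; rewrite /ip -RintegralD//; [|exact: sqint_mul..].
by apply: eq_Rintegral => x _; rewrite mulrDr.
Qed.

Lemma ipZr (c : R) u v : sqint u -> sqint v ->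
  ip u (fun x => c * v x) = c * ip u v.
Proof.
move=> su sv; rewrite /ip -RintegralZl//; last exact: sqint_mul.
by apply: eq_Rintegral => x _; rewrite mulrCA.
Qed.

Lemma ip_sumr (I : Type) (s : seq I) u (f : I -> T -> R) :
  sqint u -> (forall i, sqint (f i)) ->
  ip u (fun x => \sum_(i <- s) f i x) = \sum_(i <- s) ip u (f i).
Proof.
move=> su sf; elim: s => [|i s IH].
  rewrite big_nil /ip; under eq_Rintegral do rewrite big_nil mulr0.
  by rewrite Rintegral_cst// mul0r.
rewrite big_cons -IH -ipDr//; last exact: sqint_sum.
by apply: eq_Rintegral => x _; rewrite big_cons.
Qed.

Lemma ipBB u w : sqint u -> sqint w ->
  ip (fun x => u x - w x) (fun x => u x - w x) = ip u u - 2 * ip u w + ip w w.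
Proof.
move=> su sw.
have -> : (fun x => u x - w x) = (fun x => u x + (-1) * w x).
  by apply/funext => x; rewrite mulN1r.
have sN := sqintZ (-1) _ sw.
rewrite ipDr//; last exact: sqintD.
rewrite ipZr//; last exact: sqintD.
rewrite (ipC _ u) (ipC _ w) !ipDr// !ipZr// (ipC w u); ring.
Qed.

Lemma ip_ge0 u : 0 <= ip u u.
Proof. by apply: Rintegral_ge0 => x _; rewrite -expr2 sqr_ge0. Qed.

Lemma ipDD_le u v : sqint u -> sqint v ->
  ip (fun x => u x + v x) (fun x => u x + v x) <= 2 * ip u u + 2 * ip v v.
Proof.
move=> su sv; have suv := sqintD _ _ su sv.
have := ip_ge0 (fun x => u x - v x); rewrite ipBB// => h.
rewrite ipDr// (ipC _ u) (ipC _ v) !ipDr// (ipC v u); lra.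
Qed.

End square_integrable.
Arguments ip {d T R}.
Arguments sqint {d T R}.

(** * Orthonormal systems *)

Section orthonormal_system.
Context {d : measure_display} {T : measurableType d} {R : realType}.
Variables (P : probability T R) (I : choiceType) (phi : I -> T -> R).
Hypothesis sphi : forall i, sqint P (phi i).
Hypothesis ophi : forall i j, ip P (phi i) (phi j) = (i == j)%:R.

(** Indices may repeat in the list, so that concatenation is addition; [lincomb_uniq] collects the
    coefficients when distinct indices are required. *)
Definition lincomb (s : seq (R * I)) (x : T) : R := \sum_(p <- s) p.1 * phi p.2 x.

Lemma sqint_lincomb s : sqint P (lincomb s).
Proof. by apply: sqint_sum => p; exact: sqintZ. Qed.

Lemma lincomb_cat s t x : lincomb (s ++ t) x = lincomb s x + lincomb t x.
Proof. by rewrite /lincomb big_cat. Qed.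

Lemma lincomb_scale (c : R) s x :
  lincomb [seq (c * p.1, p.2) | p <- s] x = c * lincomb s x.
Proof. by rewrite /lincomb big_map mulr_sumr; apply: eq_bigr => p _; rewrite mulrA. Qed.

Lemma lincomb_uniq s : exists (F : seq I) (a : I -> R),
  uniq F /\ forall x, lincomb s x = \sum_(i <- F) a i * phi i x.
Proof.
exists (undup [seq p.2 | p <- s]), (fun i => \sum_(p <- s | p.2 == i) p.1).
split=> [|x]; first exact: undup_uniq.
under eq_bigr do rewrite mulr_suml big_mkcond.
rewrite exchange_big; apply: eq_big_seq => p ps /=.
have pu : p.2 \in undup [seq p.2 | p <- s] by rewrite mem_undup; apply: map_f.
rewrite (bigD1_seq p.2)//= ?undup_uniq// eqxx big1 ?addr0// => i.
by rewrite eq_sym => /negbTE ->.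
Qed.

(** Completing the square in each coefficient. The last sum vanishes when [a] gives the Fourier
    coefficients, which are therefore the best choice. *)
Lemma bessel_defect u (F : seq I) (a : I -> R) : sqint P u -> uniq F ->
  let w x := \sum_(i <- F) a i * phi i x in
  ip P (fun x => u x - w x) (fun x => u x - w x) =
  ip P u u - \sum_(i <- F) ip P u (phi i) ^+ 2
    + \sum_(i <- F) (a i - ip P u (phi i)) ^+ 2.
Proof.
move=> su uF w.
have sw : sqint P w by apply: sqint_sum => i; exact: sqintZ.
have sa i : sqint P (fun x => a i * phi i x) by exact: sqintZ.
rewrite ipBB// ip_sumr// [ip P w w]ip_sumr//.
have -> : \sum_(i <- F) ip P w (fun x => a i * phi i x) = \sum_(i <- F) a i ^+ 2.
  apply: eq_big_seq => i iF; rewrite ipZr// ipC ip_sumr//.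
  rewrite (bigD1_seq i)//= big1 ?addr0 => [|j ji].
    by rewrite ipZr// ophi eqxx mulr1 expr2.
  by rewrite ipZr// ophi eq_sym (negbTE ji) mulr0.
rewrite mulr_sumr -addrA -!sumrN -!big_split/=  -[RHS]addrA -big_split/=.
congr (_ + _); apply: eq_bigr => i _; rewrite ipZr//; ring.
Qed.

Definition approximable u :=
  forall e : R, 0 < e -> exists s,
    ip P (fun x => u x - lincomb s x) (fun x => u x - lincomb s x) <= e.

(** One inequality is Bessel's: the defect at the Fourier coefficients is nonnegative. Conversely, a
    combination at squared distance at most [e] forces a finite partial sum to reach
    [ip P u u - e]. *)
Theorem parseval u : sqint P u -> approximable u ->
  \esum_(i in [set: I]) (ip P u (phi i) ^+ 2)%:E = (ip P u u)%:E.
Proof.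
move=> su au; apply/eqP; rewrite eq_le; apply/andP; split.
  apply: ge_ereal_sup => _ [F [finF _] <-].
  rewrite fsbig_finite//= sumEFin lee_fin.
  rewrite -subr_ge0.
  have := bessel_defect u (finmap.enum_fset (fset_set F)) (fun i => ip P u (phi i))
    su (finmap.fset_uniq _).
  rewrite /= [X in _ = _ + X]big1 ?addr0 => [<-|i _]; first exact: ip_ge0.
  by rewrite subrr expr0n.
apply/lee_addgt0Pr => e e0; have [s se] := au e e0.
have [F [a [uF sE]]] := lincomb_uniq s.
move: se; rewrite (_ : (fun x => _) =
  (fun x => u x - \sum_(i <- F) a i * phi i x)); last first.
  by apply/funext => x; rewrite sE.
rewrite bessel_defect// => se.
apply: (@le_trans _ _ (\sum_(i <- F) (ip P u (phi i) ^+ 2)%:E + e%:E)%E).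
  rewrite sumEFin -EFinD lee_fin.
  have : 0 <= \sum_(i <- F) (a i - ip P u (phi i)) ^+ 2.
    by apply: sumr_ge0 => i _; exact: sqr_ge0.
  by move: se; lra.
rewrite leeD2r//; apply: ereal_sup_ubound; exists [set` F] => //.
by rewrite -fsbig_seq.
Qed.

Lemma approximable_lincomb s : approximable (lincomb s).
Proof.
move=> e e0; exists s; rewrite /ip; under eq_Rintegral do rewrite subrr mul0r.
by rewrite Rintegral_cst// mul0r ltW.
Qed.

Lemma approximableD u v : sqint P u -> sqint P v ->
  approximable u -> approximable v -> approximable (fun x => u x + v x).
Proof.
move=> su sv au av e e0.
(* The factors 2 in [ipDD_le] turn two errors of [e / 4] into [e]. *)
have e40 : 0 < e / 4 by rewrite divr_gt0.
have [[s hs] [t ht]] := (au _ e40, av _ e40); exists (s ++ t).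
set f := fun x => u x - lincomb s x; set g := fun x => v x - lincomb t x.
have sf : sqint P f by apply: sqintB => //; exact: sqint_lincomb.
have sg : sqint P g by apply: sqintB => //; exact: sqint_lincomb.
have -> : (fun x => u x + v x - lincomb (s ++ t) x) = (fun x => f x + g x).
  by apply/funext => x; rewrite lincomb_cat /f /g; ring.
by apply: (le_trans (ipDD_le _ _ _ sf sg)); lra.
Qed.

Lemma approximableZ (c : R) u : sqint P u ->
  approximable u -> approximable (fun x => c * u x).
Proof.
move=> su au e e0.
(* Dividing [e] by [c ^+ 2 + 1] instead of [c ^+ 2] covers [c = 0]. *)
have c0 : 0 < c ^+ 2 + 1 by rewrite ltr_wpDl// sqr_ge0.
have [s hs] := au _ (divr_gt0 e0 c0); exists [seq (c * p.1, p.2) | p <- s].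
set f := fun x => u x - lincomb s x in hs *.
have sf : sqint P f by apply: sqintB => //; exact: sqint_lincomb.
have -> : (fun x => c * u x - lincomb [seq (c * p.1, p.2) | p <- s] x) =
    (fun x => c * f x) by apply/funext => x; rewrite lincomb_scale mulrBr.
rewrite ipZr//; last exact: sqintZ.
rewrite ipC ipZr// mulrA -expr2.
rewrite ler_pdivlMr// in hs; have := ip_ge0 P f; nra.
Qed.

Lemma approximable_closed u : sqint P u ->
  (forall e, 0 < e -> exists v, [/\ sqint P v, approximable v &
     ip P (fun x => u x - v x) (fun x => u x - v x) <= e]) ->
  approximable u.
Proof.
move=> su H e e0; have e40 : 0 < e / 4 by rewrite divr_gt0.
have [v [sv av uv]] := H _ e40; have [s vs] := av _ e40; exists s.
set f := fun x => u x - v x in uv; set g := fun x => v x - lincomb s x in vs.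
have sf : sqint P f by apply: sqintB.
have sg : sqint P g by apply: sqintB => //; exact: sqint_lincomb.
have -> : (fun x => u x - lincomb s x) = (fun x => f x + g x).
  by apply/funext => x; rewrite /f /g; ring.
by apply: (le_trans (ipDD_le _ _ _ sf sg)); lra.
Qed.

(** Dominated convergence, applied to the squared differences, gives convergence in mean square, and
    the closed span is closed under it. *)
Lemma approximable_dominated u (v : (T -> R)^nat) G :
  sqint P u -> sqint P G -> (forall n, sqint P (v n)) ->
  (forall n, approximable (v n)) ->
  (forall n x, (u x - v n x) ^+ 2 <= G x ^+ 2) ->
  {ae P, forall x, v ^~ x @ \oo --> u x} ->
  approximable u.
Proof.
move=> su sG sv av uvG vu; apply: approximable_closed => // e e0.
pose h n x := ((u x - v n x) ^+ 2)%:E.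
have [mu _] := su; have [_ iG] := sG.
have mh n : measurable_fun setT (h n).
  have [mv _] := sv n; apply/measurable_EFinP; apply: measurable_funX.
  exact: measurable_funB.
have hG : {ae P, forall x n, setT x -> (`|h n x| <= (G x ^+ 2)%:E)%E}.
  by apply/aeW => x n _; rewrite /h /= ger0_norm ?sqr_ge0// lee_fin.
have h0 : {ae P, forall x, setT x -> h ^~ x @ \oo --> (cst 0%E : T -> \bar R) x}.
  apply: filterS vu => x vx _; apply/fine_cvgP; split; first exact: nearW.
  rewrite /comp/= (_ : 0 = (u x - u x) ^+ 2); last by rewrite subrr expr0n.
  by apply: cvgM; apply: cvgB => //; exact: cvg_cst.
have [_ _ H] := dominated_convergence measurableT mh (measurable_cst _) h0 iG hG.
move: H; rewrite integral0 => /fine_cvgP[_ /cvgrPdist_le /(_ _ e0)] [N _ /(_ N)].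
move=> /(_ (leqnn N)); rewrite sub0r normrN => hN.
exists (v N); split => //; apply: le_trans hN; apply: le_trans (ler_norm _).
rewrite /ip /Rintegral /h/= le_eqVlt; apply/orP; left; apply/eqP; congr fine.
Qed.

End orthonormal_system.

(** * Density of an algebra of functions *)

Section jewett.
Context {R : realType}.

Lemma bernoulli_ineq (x : R) n : -1 <= x -> 1 + n%:R * x <= (1 + x) ^+ n.
Proof.
move=> x1; elim: n => [|n IH]; first by rewrite mul0r addr0 expr0.
rewrite exprS; have x10 : 0 <= 1 + x by lra.
apply: le_trans (ler_wpM2l x10 IH); rewrite -natr1.
have : 0 <= n%:R * x ^+ 2 by rewrite mulr_ge0// sqr_ge0.
rewrite expr2; lra.
Qed.

(* Jewett's polynomials: on [0, 1] they tend to 0 below 1/2 and to 1 above, by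
   Bernoulli's inequality. *)
Definition jewett n (t : R) := 1 - (1 - t ^+ n) ^+ (2 ^ n).

Lemma jewett01 n t : 0 <= t <= 1 -> 0 <= jewett n t <= 1.
Proof.
move=> /andP[t0 t1]; rewrite /jewett.
have tn : 0 <= 1 - t ^+ n <= 1.
  by rewrite subr_ge0 exprn_ile1//= lerBlDr lerDl exprn_ge0.
have /andP[h0 h1] : 0 <= (1 - t ^+ n) ^+ (2 ^ n) <= 1.
  by move/andP: tn => [a b]; rewrite exprn_ge0//= exprn_ile1.
by rewrite subr_ge0 h1 lerBlDr lerDl.
Qed.

(** Bernoulli's inequality at [- t ^+ n] with exponent [2 ^ n]. *)
Lemma jewett_lt n t : 0 <= t <= 1 -> jewett n t <= (2 * t) ^+ n.
Proof.
move=> /andP[t0 t1]; rewrite /jewett.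
have h : -1 <= - t ^+ n by rewrite lerN2 exprn_ile1.
have := bernoulli_ineq _ (2 ^ n) h.
rewrite natrX exprMn; lra.
Qed.

(** Multiplying the power of [1 - t ^+ n] by that of [1 + t ^+ n] gives at most 1, while Bernoulli's
    inequality bounds the second factor below by [(2 * t) ^+ n]. *)
Lemma jewett_gt n t : 0 < t <= 1 -> 1 - (2 * t)^-1 ^+ n <= jewett n t.
Proof.
move=> /andP[t0 t1]; rewrite /jewett lerB//.
have tn0 : 0 < t ^+ n by rewrite exprn_gt0.
have h : -1 <= t ^+ n by lra.
have := bernoulli_ineq _ (2 ^ n) h; rewrite natrX -exprMn => B.
have p0 : 0 < (2 * t) ^+ n by rewrite exprn_gt0// mulr_gt0.
rewrite exprVn -[leRHS]div1r ler_pdivlMr//.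
have A : (1 - t ^+ n) ^+ (2 ^ n) * (1 + t ^+ n) ^+ (2 ^ n) <= 1.
  rewrite -exprMn exprn_ile1//; last by rewrite -subr_sqr expr1n lerBlDr lerDl sqr_ge0.
  by apply: mulr_ge0; [rewrite subr_ge0 exprn_ile1// ltW|lra].
apply: le_trans A; rewrite ler_wpM2l//; last by lra.
by rewrite exprn_ge0// subr_ge0 exprn_ile1// ltW.
Qed.

Lemma cvg_jewett (t : R) : 0 <= t <= 1 -> t != 2^-1 ->
  jewett ^~ t @ \oo --> ((2^-1 < t)%R%:R : R).
Proof.
move=> t01 t2; have /andP[t0 t1] := t01.
case: ltP => [gt|le] /=.
- have q : `|(2 * t)^-1| < 1.
    rewrite ger0_norm; last by rewrite invr_ge0 mulr_ge0.
    by rewrite invf_lt1; lra.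
  apply: (@squeeze_cvgr _ _ _ _ (fun n => 1 - (2 * t)^-1 ^+ n) (cst 1)).
  + apply: nearW => n; rewrite jewett_gt/=; last by rewrite t1 andbT; lra.
    by have /andP[] := jewett01 n _ t01.
  + rewrite -[X in _ --> X]subr0; apply: cvgB; first exact: cvg_cst.
    exact: cvg_expr.
  + exact: cvg_cst.
- have q : `|2 * t| < 1.
    by rewrite ger0_norm ?mulr_ge0//; move/eqP: t2; lra.
  apply: (@squeeze_cvgr _ _ _ _ (cst 0) (fun n => (2 * t) ^+ n)).
  + by apply: nearW => n; rewrite jewett_lt// andbT; have /andP[] := jewett01 n _ t01.
  + exact: cvg_cst.
  + exact: cvg_expr.
Qed.

End jewett.

(** * From the span to all square integrable functions *)

Section density.
Context {d : measure_display} {T : measurableType d} {R : realType}.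
Variables (P : probability T R) (I : choiceType) (phi : I -> T -> R).
Hypothesis sphi : forall i, sqint P (phi i).

Definition in_span (f : T -> R) := exists s, forall x, lincomb I phi s x = f x.

Hypothesis in_span1 : in_span (cst 1).
Hypothesis in_spanM : forall f g, in_span f -> in_span g -> in_span (f \* g).

Lemma in_span_comb (a b : R) f g : in_span f -> in_span g ->
  in_span (fun x => a * f x + b * g x).
Proof.
move=> [s sf] [t tg].
exists ([seq (a * p.1, p.2) | p <- s] ++ [seq (b * p.1, p.2) | p <- t]) => x.
by rewrite lincomb_cat !lincomb_scale sf tg.
Qed.

Lemma in_spanX f n : in_span f -> in_span (fun x => f x ^+ n).
Proof.
move=> sf; elim: n => [|n IH]; first exact: in_span1.
have -> : (fun x => f x ^+ n.+1) = f \* (fun x => f x ^+ n).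
  by apply/funext => x; rewrite exprS.
exact: in_spanM.
Qed.

Lemma in_span_onem f : in_span f -> in_span (fun x => 1 - f x).
Proof.
move=> sf; have [s hs] := in_span_comb 1 (-1) _ _ in_span1 sf.
by exists s => x; rewrite hs mul1r mulN1r.
Qed.

(** The bounds 0 and 1 survive products and let the constant 1 dominate the squared error when [f]
    is an indicator. *)
Definition bdlim (f : T -> R) := exists w : (T -> R)^nat,
  [/\ forall n, in_span (w n), forall n x, 0 <= w n x <= 1 &
      {ae P, forall x, w ^~ x @ \oo --> f x}].

Lemma bdlimM f g : bdlim f -> bdlim g -> bdlim (f \* g).
Proof.
move=> [v [sv v01 vf]] [w [sw w01 wg]]; exists (fun n => v n \* w n); split.
- by move=> n; exact: in_spanM.
- move=> n x; have /andP[? ?] := v01 n x; have /andP[? ?] := w01 n x.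
  by rewrite mulr_ge0//= mulr_ile1.
- by apply: filterS2 vf wg => x vx wx; exact: cvgM.
Qed.

(** The span is an algebra with unit, so it contains the Jewett polynomials of [f]. *)
Lemma bdlim_half f : in_span f -> (forall x, 0 <= f x <= 1) ->
  {ae P, forall x, f x != 2^-1} ->
  bdlim (fun x => (2^-1 < f x)%R%:R).
Proof.
move=> sf f01 f2; exists (fun n x => jewett n (f x)); split.
- by move=> n; do 2 (apply/in_span_onem/in_spanX).
- by move=> n x; exact: jewett01.
- by apply: filterS f2 => x fx; exact: cvg_jewett.
Qed.

Local Notation approx := (approximable P I phi).

Lemma approximable_in_span f : in_span f -> approx f.
Proof.
move=> [s hs]; rewrite (_ : f = lincomb I phi s); last by apply/funext => x; rewrite hs.
exact: approximable_lincomb.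
Qed.

Lemma approximable_sum (J : Type) (s : seq J) (f : J -> T -> R) :
  (forall j, sqint P (f j)) -> (forall j, approx (f j)) ->
  approx (fun x => \sum_(j <- s) f j x).
Proof.
move=> sf af; elim: s => [|i s IH].
  apply: approximable_in_span; exists [::] => x.
  by rewrite /lincomb !big_nil.
under eq_fun do rewrite big_cons.
by apply: approximableD => //; exact: sqint_sum.
Qed.

Lemma sqint_indic A : measurable A -> sqint P (\1_A : T -> R).
Proof.
move=> mA; apply: (sqint_bounded _ _ 1); first exact: measurable_indic.
by move=> x; rewrite indicE; case: (_ \in _); rewrite ?normr1 ?normr0.
Qed.

Definition bdlim_sets := [set A | measurable A /\ bdlim \1_A].

Hypothesis gen : @measurable _ T = <<s bdlim_sets >>.

Lemma approximable_indic A : measurable A -> approx (\1_A : T -> R).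
Proof.
move=> mA; have : <<s bdlim_sets >> A by rewrite -gen.
have s1 : sqint P (cst 1 : T -> R).
  by apply: (sqint_bounded _ _ 1) => // x; rewrite normr1.
(* The goals are, in order: stability of the generators under intersection, the whole space, the
   generators, complements, disjoint countable unions. *)
move: A {mA}; apply: dynkin_induction => //.
- move=> A B [mA lA] [mB lB]; split; first exact: measurableI.
  by rewrite indicI; exact: bdlimM.
- by rewrite indicT; exact: approximable_in_span.
- move=> A [mA [w [sw w01 wA]]].
  apply: (approximable_dominated _ _ _ sphi _ w (cst 1)) => //.
  + exact: sqint_indic.
  + move=> n; have [s hs] := sw n.
    by rewrite (_ : w n = lincomb I phi s); [exact: sqint_lincomb|apply/funext => x; rewrite hs].
  + by move=> n; exact: approximable_in_span.
  + move=> n x; have /andP[? ?] := w01 n x; rewrite indicE; case: (_ \in _) => /=; nra.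
- move=> A mA aA; have sA := sqint_indic _ mA.
  have := approximableD _ _ _ sphi _ _ s1 (sqintZ _ (-1) _ sA)
    (approximable_in_span _ in_span1) (approximableZ _ _ _ sphi (-1) _ sA aA).
  congr approx; apply/funext => x; rewrite !indicE in_setC.
  by case: (_ \in _); rewrite /= mulN1r ?subrr ?oppr0 ?addr0.
- move=> F mF tF aF.
  have E0 n x : ~ (\bigcup_k F k) x -> \sum_(k < n) \1_(F k) x = 0 :> R.
    move=> Fx; apply: big1 => k _; rewrite indicE memNset//.
    by move=> Fkx; apply: Fx; exists k.
  (* Disjointness leaves only the term [k = j], so the partial sums step once from 0 to 1. *)
  have E1 n x j : F j x -> \sum_(k < n) \1_(F k) x = (j < n)%:R :> R.
    move=> Fjx; have Fk k : \1_(F k) x = (k == j)%:R :> R.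
      rewrite indicE; have [->|kj] := eqVneq k j; first by rewrite mem_set.
      rewrite memNset// => Fkx; move/eqP: kj; apply.
      by apply: (tF k j) => //; exists x.
    under eq_bigr do rewrite Fk.
    case: ltnP => jn.
      rewrite (bigD1 (Ordinal jn))//= eqxx big1 ?addr0// => k kj.
      by case: eqP => // kjE; case/eqP: kj; exact: val_inj.
    by rewrite big1// => k _; rewrite ltn_eqF// (leq_trans (ltn_ord k)).
  apply: (approximable_dominated _ _ _ sphi _
    (fun n x => \sum_(k < n) \1_(F k) x) (cst 1)) => //.
  + by apply: sqint_indic; exact: bigcupT_measurable.
  + by move=> n; apply: sqint_sum => k; exact: sqint_indic.
  + by move=> n; apply: approximable_sum => k //; exact: sqint_indic.
  + move=> n x; have [[j _ Fjx]|Fx] := pselect ((\bigcup_k F k) x).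
      rewrite (E1 _ _ _ Fjx) indicE mem_set; last by exists j.
      by case: ltnP => _ /=; rewrite ?subrr ?subr0 ?expr0n ?expr1n.
    by rewrite E0// indicE memNset// subrr expr0n expr1n.
  + apply: aeW => x; have [[j _ Fjx]|Fx] := pselect ((\bigcup_k F k) x).
      rewrite indicE mem_set; last by exists j.
      apply: cvg_near_cst; exists j.+1 => // n /= jn.
      by rewrite (E1 _ _ _ Fjx) jn.
    by apply: cvg_near_cst; apply: nearW => n; rewrite E0// indicE memNset.
Qed.

Import HBNNSimple.

(** Simple functions increase to [u]; being between 0 and [u], they have a squared error of at most
    [u ^+ 2]. *)
Lemma approximable_ge0 u : sqint P u -> (forall x, 0 <= u x) -> approx u.
Proof.
move=> su u0; have [mu _] := su.
have meu : measurable_fun setT (EFin \o u) by exact/measurable_EFinP.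
pose g := nnsfun_approx measurableT meu.
have gcvg x : (g ^~ x : R^nat) @ \oo --> u x.
  have := @cvg_nnsfun_approx _ _ _ _ measurableT _ meu (fun y _ => u0 y) x Logic.I.
  by move=> /fine_cvgP[].
have gu n x : g n x <= u x.
  rewrite -(cvg_lim (@Rhausdorff R) (gcvg x)).
  apply: nondecreasing_cvgn_le; last by apply/cvg_ex; exists (u x).
  by move=> m k mk; apply/lefP; exact: nd_nnsfun_approx.
have sg n : sqint P (g n).
  have [mu2 iu2] := su; split => //.
  apply: (le_integrable measurableT _ _ iu2).
    by apply/measurable_EFinP; exact: measurable_funX.
  move=> x _ /=; rewrite lee_fin !ger0_norm ?sqr_ge0//.
  by rewrite lerXn2r ?nnegrE.
apply: (approximable_dominated _ _ _ sphi _ (fun n => g n) u) => //.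
- move=> n; rewrite (_ : (g n : T -> R) = fun x =>
    \sum_(r <- finmap.enum_fset (fset_set (range (g n)))) r * \1_(g n @^-1` [set r]) x).
    apply: approximable_sum => r.
      by apply: sqintZ; apply: sqint_indic; exact: measurable_funPTI.
    apply: approximableZ => //; first by apply: sqint_indic; exact: measurable_funPTI.
    by apply: approximable_indic; exact: measurable_funPTI.
  by apply/funext => x; rewrite {1}fimfunE fsbig_finite.
- by move=> n x; have := gu n x; have : 0 <= g n x by []; have := u0 x; nra.
- exact: aeW.
Qed.

Lemma sqint_le (u v : T -> R) : measurable_fun setT v -> sqint P u ->
  (forall x, `|v x| <= `|u x|) -> sqint P v.
Proof.
move=> mv [mu iu] vu; split => //; apply: (le_integrable measurableT _ _ iu).
  by apply/measurable_EFinP; exact: measurable_funX.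
by move=> x _ /=; rewrite lee_fin !normrX lerXn2r ?nnegrE.
Qed.

Theorem approximable_sqint u : sqint P u -> approx u.
Proof.
move=> su; have [mu _] := su.
have s1 : sqint P u^\+.
  apply: (sqint_le _ _ _ su); first exact: measurable_funrpos.
  by move=> x; rewrite /funrpos maxEle; case: ifP => _; rewrite ?normr0.
have s2 : sqint P u^\-.
  apply: (sqint_le _ _ _ su); first exact: measurable_funrneg.
  by move=> x; rewrite /funrneg maxEle; case: ifP => _; rewrite ?normr0 ?normrN.
have := approximableD _ _ _ sphi _ _ s1 (sqintZ _ (-1) _ s2)
  (approximable_ge0 _ s1 (funrpos_ge0 u))
  (approximableZ _ _ _ sphi (-1) _ s2 (approximable_ge0 _ s2 (funrneg_ge0 u))).
congr approx; rewrite -[RHS]funrposBneg; apply/funext => x.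
by rewrite mulN1r.
Qed.

End density.

(** * Fourier series on the unit cube *)

Lemma measurable_avoid {R : realType} (a : R) :
  measurable [set x : R | ~ (0 < x < 1 /\ x != a)].
Proof.
set N : set R := [set x | _].
have -> : N = ~` (`]0, 1[%classic `\` [set a]).
  apply/seteqP; split => x /= H; contra: H.
    by move=> [+ /eqP xa]; rewrite in_itv/= => x01; split.
  by move=> [x01 xa]; rewrite in_itv/=; split => //; exact/eqP.
by apply: measurableC; apply: measurableD; [exact: measurable_itv|exact: measurable_set1].
Qed.

(** Within [0, 1] the set contains at most 0, 1 and [a], the points where the sines used in
    [bdlim_ray] can vanish. *)
Lemma uniform01_avoid {R : realType} (a : R) :
  uniform01 [set x : R | ~ (0 < x < 1 /\ x != a)] = 0%E.
Proof.
set N : set R := [set x | _]; have mN : measurable N := measurable_avoid a.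
rewrite -[X in uniform01 X](setIT N) -integral_indic// integral_uniform//; last first.
  by apply/measurable_EFinP; exact: measurable_indic.
rewrite subr0 invr1 mul1e integral_indic//.
apply: countable_lebesgue_measure0; apply: (@sub_countable _ _ _ [set 0; 1; a]).
  apply: subset_card_le; move=> x [Nx /=]; rewrite in_itv/= => /andP[x0 x1].
  apply: contrapT => H; apply: Nx; split.
    rewrite !lt_neqAle x0 x1 !andbT; apply/andP; split; apply/eqP => E; apply: H.
      by left; left.
    by left; right.
  by apply/eqP => E; apply: H; right.
by apply: finite_set_countable; rewrite !finite_setU; split=> //; split.
Qed.

Section trigonometric_system.
Context {R : realType} (n : nat) (P : probability (n.-tuple R) R).
Hypothesis Pmarginal : forall i A, measurable A ->
  P ((fun x => tnth x i) @^-1` A) = uniform01 A.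
Hypothesis Pcos : forall (m : n.-tuple int) t,
  (\int[P]_x (cos (2 * pi * zdot n m x + t))%:E =
     ((all (eq_op 0) m)%:R * cos t)%:E)%E.

Definition zcos (m : n.-tuple int) (x : n.-tuple R) : R := cos (2 * pi * zdot n m x).
Definition zsin (m : n.-tuple int) (x : n.-tuple R) : R := sin (2 * pi * zdot n m x).
(* Hartley's kernel: with m ranging over all of Z^n it gives a real orthonormal
   basis, without the separate treatment of m = 0 that cos and sin require. *)
Definition cas (m : n.-tuple int) (x : n.-tuple R) : R := zcos m x + zsin m x.

Definition zadd (m l : n.-tuple int) := [tuple tnth m i + tnth l i | i < n].
Definition zopp (m : n.-tuple int) := [tuple - tnth m i | i < n].

Lemma tnth_zadd m l i : tnth (zadd m l) i = tnth m i + tnth l i.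
Proof. exact: tnth_mktuple. Qed.

Lemma tnth_zopp m i : tnth (zopp m) i = - tnth m i.
Proof. exact: tnth_mktuple. Qed.

Lemma zdotD m l (x : n.-tuple R) : zdot n (zadd m l) x = zdot n m x + zdot n l x.
Proof.
rewrite /zdot -big_split/=; apply: eq_bigr => i _.
by rewrite tnth_zadd intrD mulrDl.
Qed.

Lemma zdotN m (x : n.-tuple R) : zdot n (zopp m) x = - zdot n m x.
Proof.
rewrite /zdot -sumrN; apply: eq_bigr => i _.
by rewrite tnth_zopp intrN mulNr.
Qed.

Lemma zoppK : involutive zopp.
Proof. by move=> m; apply: eq_from_tnth => i; rewrite !tnth_zopp opprK. Qed.

Lemma zcosN m x : zcos (zopp m) x = zcos m x.
Proof. by rewrite /zcos zdotN mulrN cosN. Qed.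

Lemma zsinN m x : zsin (zopp m) x = - zsin m x.
Proof. by rewrite /zsin zdotN mulrN sinN. Qed.

Lemma measurable_zcos m : measurable_fun setT (zcos m).
Proof.
have := measurable_cos_zdot n m (0 : R).
by under eq_fun do rewrite addr0.
Qed.

Lemma measurable_zsin m : measurable_fun setT (zsin m).
Proof.
have := measurable_cos_zdot n m (- (pi / 2) : R).
by under eq_fun do rewrite cosBpihalf.
Qed.

Lemma sqint_zcos m : sqint P (zcos m).
Proof. by apply: (sqint_bounded _ _ 1); [exact: measurable_zcos|move=> x; exact: cos_max]. Qed.

Lemma sqint_zsin m : sqint P (zsin m).
Proof. by apply: (sqint_bounded _ _ 1); [exact: measurable_zsin|move=> x; exact: sin_max]. Qed.

Lemma sqint_cas m : sqint P (cas m).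
Proof. by apply: sqintD; [exact: sqint_zcos|exact: sqint_zsin]. Qed.

Lemma casM m l x : cas m x * cas l x = zcos (zadd m (zopp l)) x + zsin (zadd m l) x.
Proof.
rewrite /cas /zcos /zsin !zdotD zdotN !mulrDr mulrN cosB sinD; ring.
Qed.

Lemma cas_orthonormal m l : ip P (cas m) (cas l) = (m == l)%:R.
Proof.
rewrite /ip; under eq_Rintegral do rewrite casM.
have i1 (f : n.-tuple R -> R) : measurable_fun setT f -> (forall x, `|f x| <= 1) ->
    P.-integrable setT (EFin \o f) by exact: bounded_integrable.
rewrite RintegralD//; first last.
- by apply: i1 => [|x]; [exact: measurable_zsin|exact: sin_max].
- by apply: i1 => [|x]; [exact: measurable_zcos|exact: cos_max].
rewrite /Rintegral.
under eq_integral do rewrite /zcos -[2 * _ * _]addr0.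
rewrite Pcos cos0 mulr1.
(* A sine is a cosine of phase [- (pi / 2)]; its integral is 0 even at frequency zero, because the
   cosine of that phase is 0. *)
under [in X in _ + X]eq_integral do rewrite /zsin -cosBpihalf.
rewrite Pcos/= -[- (pi / 2)]add0r cosBpihalf sin0 mulr0 addr0; congr (_%:R).
congr nat_of_bool; apply/allP/eqP => [H|-> z zl].
  apply: eq_from_tnth => i; have := H _ (mem_tnth i (zadd m (zopp l))).
  by rewrite tnth_zadd tnth_zopp eq_sym subr_eq0 => /eqP.
have [i ->] := @elimT _ _ (@tnthP _ _ (zadd l (zopp l)) z) zl.
by rewrite tnth_zadd tnth_zopp subrr.
Qed.

Local Notation inS := (in_span (n.-tuple int : choiceType) cas).

Lemma in_span_cas m : inS (cas m).
Proof. by exists [:: (1, m)] => x; rewrite /lincomb big_seq1 mul1r. Qed.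

Lemma in_span_ext f g : inS f -> f =1 g -> inS g.
Proof. by move=> [s hs] fg; exists s => x; rewrite hs fg. Qed.

Lemma in_span_zcos m : inS (zcos m).
Proof.
apply: (in_span_ext _ _ (in_span_comb _ _ 2^-1 2^-1 _ _
  (in_span_cas m) (in_span_cas (zopp m)))).
move=> x; rewrite /cas zcosN zsinN; lra.
Qed.

Lemma in_span_zsin m : inS (zsin m).
Proof.
apply: (in_span_ext _ _ (in_span_comb _ _ 2^-1 (- 2^-1) _ _
  (in_span_cas m) (in_span_cas (zopp m)))).
move=> x; rewrite /cas zcosN zsinN; lra.
Qed.

Lemma in_span_trig1 : inS (cst 1).
Proof.
apply: (in_span_ext _ _ (in_span_zcos [tuple 0 | i < n])) => x.
rewrite /zcos /zdot big1 ?mulr0 ?cos0// => i _.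
by rewrite tnth_mktuple mul0r.
Qed.

Lemma in_span_trigM f g : inS f -> inS g -> inS (f \* g).
Proof.
have in_sum (s : seq (R * n.-tuple int)) (h : n.-tuple int -> n.-tuple R -> R) :
    (forall m, inS (h m)) -> inS (fun x => \sum_(p <- s) p.1 * h p.2 x).
  move=> sh; elim: s => [|p s IH].
    by exists [::] => x; rewrite /lincomb !big_nil.
  apply: (in_span_ext _ _ (in_span_comb _ _ p.1 1 _ _ (sh p.2) IH)) => x.
  by rewrite big_cons mul1r.
move=> [s sf] [t tg].
have H m : inS (fun x => cas m x * g x).
  have Hm l : inS (fun x => cas m x * cas l x).
    apply: (in_span_ext _ _ (in_span_comb _ _ 1 1 _ _
      (in_span_zcos (zadd m (zopp l))) (in_span_zsin (zadd m l)))).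
    by move=> x; rewrite !mul1r casM.
  apply: (in_span_ext _ _ (in_sum t _ Hm)) => x.
  by rewrite -tg /lincomb mulr_sumr; apply: eq_bigr => p _; rewrite mulrCA.
apply: (in_span_ext _ _ (in_sum s _ H)) => x.
by rewrite /= -sf /lincomb mulr_suml; apply: eq_bigr => p _; rewrite mulrA.
Qed.

Lemma ae_coordinate i (a : R) :
  {ae P, forall x, 0 < tnth x i < 1 /\ tnth x i != a}.
Proof.
set N := [set x : R | ~ (0 < x < 1 /\ x != a)].
have mN : measurable N by exact: measurable_avoid.
exists ((fun x => tnth x i) @^-1` N); split => //.
- by rewrite -[X in measurable X]setTI; exact: measurable_tnth.
- by rewrite -[RHS](uniform01_avoid a) -(Pmarginal i).
Qed.

Local Notation bd := (bdlim P (n.-tuple int : choiceType) cas).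

Lemma bdlim_ae f g : bd f -> {ae P, forall x, f x = g x} -> bd g.
Proof.
move=> [w [sw w01 wf]] fg; exists w; split => //.
by apply: filterS2 wf fg => x wx <-.
Qed.

(** Almost every coordinate lies in (0, 1), so the indicator is almost everywhere constant unless
    [a] does too. In that case a trigonometric [f] exceeds 1/2 exactly on the ray, up to a null set,
    and [bdlim_half] applies. *)
Lemma bdlim_ray i (a : R) : bd (\1_[set x : n.-tuple R | a < tnth x i]).
Proof.
have cst_bd (b : bool) : bd (cst b%:R).
  exists (fun _ => cst b%:R); split => [_|_ x|].
  - case: b; first exact: in_span_trig1.
    by exists [::] => x; rewrite /lincomb big_nil.
  - by case: b; rewrite lexx ler01.
  - by apply: aeW => x; exact: cvg_cst.
have [a0|a0] := leP a 0.
  apply: (bdlim_ae _ _ (cst_bd true)); apply: filterS (ae_coordinate i a).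
  by move=> x [/andP[x0 x1] _]; rewrite indicE mem_set//=; exact: le_lt_trans a0 x0.
have [a1|a1] := leP 1 a.
  apply: (bdlim_ae _ _ (cst_bd false)); apply: filterS (ae_coordinate i a).
  move=> x [/andP[x0 x1] _]; rewrite indicE memNset//=.
  by apply/negP; rewrite -leNgt ltW// (lt_le_trans x1).
pose e : n.-tuple int := [tuple (j == i)%:Z | j < n].
have ze (x : n.-tuple R) : zdot n e x = tnth x i.
  rewrite /zdot (bigD1 i)//= tnth_mktuple eqxx mul1r big1 ?addr0// => j ji.
  by rewrite tnth_mktuple (negbTE ji) mul0r.
(* On (0, 1) the sign of sin (pi (x_i - a)) sin (pi x_i) is that of x_i - a. *)
pose f (x : n.-tuple R) := (1 + sin (pi * (tnth x i - a)) * sin (pi * tnth x i)) / 2.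
(* The product of the two sines of half-integer frequency is half of [cos (pi * a)] minus a cosine
   of frequency 1 and phase [- (pi * a)]. *)
have sf : inS f.
  have := in_span_comb _ _ (- (cos (pi * a) / 4)) (- (sin (pi * a) / 4)) _ _
    (in_span_zcos e) (in_span_zsin e).
  move=> /(in_span_comb _ _ (2^-1 + cos (pi * a) / 4) 1 _ _ in_span_trig1).
  move=> /in_span_ext; apply => x; rewrite /zcos /zsin ze /f /=.
  have -> : 2 * pi * tnth x i = (pi * tnth x i) *+ 2 by rewrite -mulrA mulr_natl.
  rewrite cos_mulr2n sin_mulr2n [pi * (_ - a)]mulrBr sinB.
  have h : cos (pi * a) * (cos (pi * tnth x i) ^+ 2 + sin (pi * tnth x i) ^+ 2) =
    cos (pi * a) by rewrite cos2Dsin2 mulr1.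
  lra.
have f01 x : 0 <= f x <= 1.
  have := sin_max (pi * (tnth x i - a)); have := sin_max (pi * tnth x i).
  rewrite /f !ler_norml => /andP[? ?] /andP[? ?]; apply/andP; split; nra.
have fsg (x : n.-tuple R) : 0 < tnth x i < 1 -> tnth x i != a ->
    f x != 2^-1 /\ (2^-1 < f x) = (a < tnth x i).
  move=> /andP[x0 x1] xa; have pi0 := @pi_gt0 R; set t := tnth x i in x0 x1 xa *.
  have sx : 0 < sin (pi * t).
    by apply: sin_gt0_pi; rewrite mulr_gt0//= gtr_pMr.
  rewrite /f -/t; case: (ltgtP a t) xa => // at_ _.
    have : 0 < sin (pi * (t - a)).
      by apply: sin_gt0_pi; rewrite mulr_gt0 ?subr_gt0//= gtr_pMr//; lra.
    by move=> /mulr_gt0/(_ sx) h; split; [apply/eqP; lra|apply/idP; lra].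
  have : 0 < sin (pi * (a - t)).
    by apply: sin_gt0_pi; rewrite mulr_gt0 ?subr_gt0//= gtr_pMr//; lra.
  rewrite -opprB mulrN sinN => /mulr_gt0/(_ sx) h.
  by split; [apply/eqP; lra|apply/negbTE; rewrite -leNgt; lra].
apply: (bdlim_ae _ _ (bdlim_half _ _ _ in_span_trig1 in_span_trigM _ sf f01 _)).
  by apply: filterS (ae_coordinate i a) => x [x01 xa]; have [] := fsg x x01 xa.
apply: filterS (ae_coordinate i a) => x [x01 xa]; have [_ ->] := fsg x x01 xa.
rewrite indicE; congr (nat_of_bool _)%:R; apply/idP/idP => [H|/set_mem//].
exact: mem_set.
Qed.

Lemma measurable_bdlim :
  @measurable _ (n.-tuple R) = <<s bdlim_sets P (n.-tuple int : choiceType) cas >>.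
Proof.
set G := bdlim_sets _ _ _.
have sG : sigma_algebra setT <<s G >> by exact: smallest_sigma_algebra.
apply/seteqP; split; last first.
  apply: smallest_sub; first exact: sigma_algebra_measurable.
  by move=> A [].
apply: smallest_sub => //.
move=> A; rewrite -bigcup_seq => -[i /= _ [B mB <-]]; rewrite setTI.
have : <<s @RGenOInfty.G R >> B.
  by move: mB; rewrite /measurable/= /measurableR RGenOInfty.measurableE.
(* The sets [B] whose preimage under the coordinate lies in [<<s G >>] form a sigma-algebra; it
   remains to treat the open rays that generate the Borel sets. *)
move: B {mB}; apply: smallest_sub.
  have := sigma_algebra_image (fun x : n.-tuple R => tnth x i) sG.
  by rewrite /image_set_system; under eq_set do rewrite setTI.
move=> _ [x ->]; apply: sub_sigma_algebra; split.
  by rewrite -[X in measurable X]setTI; apply: measurable_tnth => //; exact: measurable_itv.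
rewrite (_ : _ @^-1` _ = [set y : n.-tuple R | x < tnth y i]); first exact: bdlim_ray.
by apply/seteqP; split => y /=; rewrite in_itv/= andbT.
Qed.

Theorem parseval_cas u : sqint P u ->
  \esum_(m in [set: n.-tuple int]) (ip P u (cas m) ^+ 2)%:E = (ip P u u)%:E.
Proof.
move=> su; apply: parseval => //; [exact: sqint_cas|exact: cas_orthonormal|].
apply: approximable_sqint => //; [exact: sqint_cas|exact: in_span_trig1| |].
  exact: in_span_trigM.
exact: measurable_bdlim.
Qed.

(* Adding the terms of index m and -m turns the coefficients of u + iv into the
   cas coefficients of u and of v. *)
Theorem parseval_fourier u v : sqint P u -> sqint P v ->
  \esum_(m in [set: n.-tuple int])
    ((ip P u (zcos m) + ip P v (zsin m)) ^+ 2 +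
     (ip P v (zcos m) - ip P u (zsin m)) ^+ 2)%:E = (ip P u u + ip P v v)%:E.
Proof.
move=> su sv; set a := fun m : n.-tuple int => _.
have a0 m : (0 <= a m)%E by rewrite lee_fin addr_ge0 ?sqr_ge0.
have neg (b : n.-tuple int -> \bar R) :
    \esum_(m in [set: n.-tuple int]) b m = \esum_(m in [set: n.-tuple int]) b (zopp m).
  apply: reindex_esum; split => //; first by move=> x y _ _; exact: (inv_inj zoppK).
  by move=> x _; exists (zopp x) => //; rewrite zoppK.
have ipsN f m : sqint P f -> ip P f (zsin (zopp m)) = - ip P f (zsin m).
  move=> sf; rewrite -mulN1r -ipZr//; last exact: sqint_zsin.
  by apply: eq_Rintegral => x _; rewrite zsinN mulN1r.
have ipcN f m : ip P f (zcos (zopp m)) = ip P f (zcos m).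
  by apply: eq_Rintegral => x _; rewrite zcosN.
have ipcas f m : sqint P f -> ip P f (cas m) = ip P f (zcos m) + ip P f (zsin m).
  by move=> sf; rewrite -ipDr//; [exact: sqint_zcos|exact: sqint_zsin].
pose b f (m : n.-tuple int) := (ip P f (cas m) ^+ 2)%:E.
have b0 f m : (0 <= b f m)%E by rewrite lee_fin sqr_ge0.
have Hc : \esum_(m in [set: n.-tuple int]) (b u m + b v m)%E =
    (ip P u u + ip P v v)%:E.
  by rewrite esumD ?EFinD -?parseval_cas.
have E : (\esum_(m in [set: n.-tuple int]) a m + \esum_(m in [set: n.-tuple int]) a m =
   (ip P u u + ip P v v)%:E + (ip P u u + ip P v v)%:E)%E.
  rewrite [X in (_ + X)%E]neg -esumD// -Hc.
  rewrite [X in _ = (_ + X)%E]neg -esumD; last 2 first.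
  - by move=> m _; rewrite adde_ge0.
  - by move=> m _; rewrite adde_ge0.
  apply: eq_esum => m _; rewrite /a /b !ipcas// !ipsN// !ipcN -!EFinD; congr EFin; ring.
(* A doubled extended real can be halved once it is known to be finite. *)
move: E; case: (esum _ _) => [r| |]//=.
by rewrite -!EFinD => -[h]; congr EFin; lra.
Qed.

End trigonometric_system.

(** * Sums over the edges of a four-to-one graph *)

Section edge_sums.
Context {R : realType}.

Lemma subset_esum (I : choiceType) (A B : set I) (f : I -> \bar R) :
  A `<=` B -> (\esum_(i in A) f i <= \esum_(i in B) f i)%E.
Proof.
move=> AB; apply: ereal_sup_le; apply: image_subset => F [finF FA].
by split => // x /FA /AB.
Qed.

Lemma esum_setU (I : choiceType) (A B : set I) (f : I -> \bar R) :
  (forall i, 0 <= f i)%E ->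
  (\esum_(i in A `|` B) f i <= \esum_(i in A) f i + \esum_(i in B) f i)%E.
Proof.
move=> f0; rewrite (esumID A)//; apply: leeD; apply: subset_esum; first by move=> x [].
by move=> x [[]].
Qed.

Lemma esum_prod4 (Y : choiceType) (b : Y -> \bar R) : (forall y, 0 <= b y)%E ->
  \esum_(p in [set: Y * 'I_4]) b p.1 = (4%:E * \esum_(y in [set: Y]) b y)%E.
Proof.
move=> b0.
have -> : [set: Y * 'I_4] = [set: Y] `*`` (fun=> [set: 'I_4]) by apply/seteqP; split.
rewrite -(@esum_esum _ _ _ _ (fun=> [set: 'I_4]) (fun y _ => b y))//.
transitivity (\esum_(y in [set: Y]) \sum_(i <- index_enum 'I_4) b y)%E.
  apply: eq_esum => y _; rewrite esum_fset//; last exact: finite_finset.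
  have -> : [set: 'I_4] = [set` index_enum 'I_4].
    by apply/seteqP; split => // i _; exact: mem_index_enum.
  by rewrite [RHS]fsbig_seq//; exact: index_enum_uniq.
rewrite (@esum_sum _ _ _ _ _ xpredT (fun y _ => b y))// !big_ord_recl big_ord0 adde0.
set S := esum _ _; have : (0 <= S)%E by exact: esum_ge0.
by case: S => [r| |]// _; rewrite -?EFinD -?EFinM; [congr EFin; lra|rewrite gt0_muley// lte_fin].
Qed.

(** A bijection onto [Y * 'I_4] encodes an exactly four-to-one map, its first component; the second
    component numbers the points of each fibre. *)
Lemma esum_fiber4 (X Y : choiceType) (Phi : X -> Y * 'I_4) (b : Y -> \bar R) :
  bijective Phi -> (forall y, 0 <= b y)%E ->
  \esum_(x in [set: X]) b (Phi x).1 = (4%:E * \esum_(y in [set: Y]) b y)%E.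
Proof.
move=> bij b0; rewrite -esum_prod4// (reindex_esum [set: X] _ Phi)//.
by rewrite setTT_bijective.
Qed.

Variables (X Y : choiceType) (A B : X -> R) (C D : Y -> R) (SX SY : R).
Hypothesis hX : \esum_(x in [set: X]) (A x ^+ 2 + B x ^+ 2)%:E = SX%:E.
Hypothesis hY : \esum_(y in [set: Y]) (C y ^+ 2 + D y ^+ 2)%:E = SY%:E.
(** This is $|z + w|^2$ for the complex coefficients $z = A + iB$ and $w = C + iD$ on the two
    cubes. *)
Let N x y := ((A x + C y) ^+ 2 + (B x + D y) ^+ 2)%:E.
Variable Phi : X -> Y * 'I_4.
Hypothesis bPhi : bijective Phi.

(** Sum $|z + w|^2 \le 2|z|^2 + 2|w|^2$; each $w$ occurs on four edges, whence the 8. *)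
Lemma edge_sum_upper :
  (\esum_(x in [set: X]) N x (Phi x).1 <= (2 * SX + 8 * SY)%:E)%E.
Proof.
pose a x := (A x ^+ 2 + B x ^+ 2)%:E; pose c y := (C y ^+ 2 + D y ^+ 2)%:E.
have a0 x : (0 <= a x)%E by rewrite lee_fin addr_ge0 ?sqr_ge0.
have c0 y : (0 <= c y)%E by rewrite lee_fin addr_ge0 ?sqr_ge0.
have hc : \esum_(x in [set: X]) c (Phi x).1 = (4 * SY)%:E.
  by rewrite esum_fiber4// hY.
have -> : (2 * SX + 8 * SY)%:E =
    \esum_(x in [set: X]) ((a x + a x) + (c (Phi x).1 + c (Phi x).1))%E.
  rewrite !esumD// ?hX ?hc; do ?by move=> *; rewrite adde_ge0.
  by rewrite -!EFinD; congr EFin; lra.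
apply: le_esum => x _; rewrite /N /a /c -!EFinD lee_fin.
move: (A x) (B x) (C _) (D _) => p q r t.
by have := sqr_ge0 (p - r); have := sqr_ge0 (q - t); nra.
Qed.

(** Sum $|w|^2 \le 2|z|^2 + 2|z + w|^2$, whose left side adds up to [4 * SY], and halve. Subtraction
    is postponed until the sum is known to be real. *)
Lemma edge_sum_lower :
  ((2 * SY - SX)%:E <= \esum_(x in [set: X]) N x (Phi x).1)%E.
Proof.
pose a x := (A x ^+ 2 + B x ^+ 2)%:E; pose c y := (C y ^+ 2 + D y ^+ 2)%:E.
have a0 x : (0 <= a x)%E by rewrite lee_fin addr_ge0 ?sqr_ge0.
have c0 y : (0 <= c y)%E by rewrite lee_fin addr_ge0 ?sqr_ge0.
have N0 x y : (0 <= N x y)%E by rewrite lee_fin addr_ge0 ?sqr_ge0.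
have hc : \esum_(x in [set: X]) c (Phi x).1 = (4 * SY)%:E.
  by rewrite esum_fiber4// hY.
have : (\esum_(x in [set: X]) c (Phi x).1 <=
    \esum_(x in [set: X]) ((a x + a x) + (N x (Phi x).1 + N x (Phi x).1)))%E.
  apply: le_esum => x _; rewrite /N /a /c -!EFinD lee_fin.
  move: (A x) (B x) (C _) (D _) => p q r t.
  by have := sqr_ge0 (2 * p + r); have := sqr_ge0 (2 * q + t); nra.
rewrite hc esumD; last 2 first.
- by move=> x _; exact: adde_ge0.
- by move=> x _; apply: adde_ge0; exact: N0.
rewrite !esumD// hX.
case: (esum _ _) => [r| |]; [|by move=> _; rewrite leey|by []].
by rewrite -!EFinD !lee_fin; lra.
Qed.

End edge_sums.

(** * Four-to-one maps between integer lattices *)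

Section bijections.
Local Open Scope card_scope.

Lemma countType_bij_nat (T : countType) (f : nat -> T) :
  injective f -> exists g : T -> nat, bijective g.
Proof.
move=> injf; have : [set: T] #= [set: nat].
  rewrite card_eq_le; apply/andP; split; first exact: countableP.
  have /andP[_ h] : (range f #<= [set: nat]) && ([set: nat] #<= range f).
    by rewrite -card_eq_le; apply: inj_card_eq => x y _ _ /injf.
  by apply: card_le_trans h _; exact: subset_card_le.
by move=> /card_set_bijP[g]; rewrite setTT_bijective => bg; exists g.
Qed.

(** Both sides are countably infinite: constant tuples embed the naturals in each. *)
Lemma bijection_fiber4 a b : (0 < a)%N -> (0 < b)%N ->
  exists phi : a.-tuple int -> b.-tuple int * 'I_4, bijective phi.
Proof.
move=> a0 b0.
have inj_nseq n : (0 < n)%N -> injective (fun i : nat => [tuple of nseq n i%:Z]).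
  by case: n => // n _ i i' /(congr1 (fun t => tnth t ord0)); rewrite !(tnth_nth 0) => -[].
have [f bf] := countType_bij_nat _ _ (inj_nseq a a0).
have [g [g' gK g'K]] : exists g : b.-tuple int * 'I_4 -> nat, bijective g.
  apply: (countType_bij_nat _ (fun i => ([tuple of nseq b i%:Z], ord0))).
  by move=> i i' [E]; apply: (inj_nseq b b0); exact: val_inj.
by exists (g' \o f); apply: bij_comp bf; exists g.
Qed.

Definition split_tuple a s (x : (a + s).-tuple int) : a.-tuple int * s.-tuple int :=
  ([tuple tnth x (lshift s i) | i < a], [tuple tnth x (rshift a i) | i < s]).

Definition join_tuple a s (x : a.-tuple int * s.-tuple int) : (a + s).-tuple int :=
  [tuple of x.1 ++ x.2].

Lemma split_tupleK a s : cancel (@split_tuple a s) (@join_tuple a s).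
Proof.
move=> x; apply: eq_from_tnth => i; rewrite -(fintype.splitK i).
by case: (fintype.split i) => j; rewrite /= ?tnth_lshift ?tnth_rshift tnth_mktuple.
Qed.

Lemma join_tupleK a s : cancel (@join_tuple a s) (@split_tuple a s).
Proof.
move=> [x y]; congr pair; apply: eq_from_tnth => i;
by rewrite tnth_mktuple ?tnth_lshift ?tnth_rshift.
Qed.

(** [phi] replaces the [a] entries private to the first cube by the [b] entries private to the
    second, and the [s] shared entries are carried over. Both ends of an edge can then be read off
    one frequency. *)
Lemma bijection_right a s b (phi : a.-tuple int -> b.-tuple int * 'I_4) :
  bijective phi ->
  exists Phi : (a + s).-tuple int -> (s + b).-tuple int * 'I_4,
    bijective Phi /\
    forall x (i : 'I_s), tnth (Phi x).1 (lshift b i) = tnth x (rshift a i).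
Proof.
move=> [psi phiK psiK].
pose F x := let: (h, t) := split_tuple a s x in
  (join_tuple s b (t, (phi h).1), (phi h).2).
pose G y := let: (t, h) := split_tuple s b y.1 in
  join_tuple a s (psi (h, y.2), t).
have FE h t : F (join_tuple a s (h, t)) = (join_tuple s b (t, (phi h).1), (phi h).2).
  by rewrite /F join_tupleK.
have GE t h i : G (join_tuple s b (t, h), i) = join_tuple a s (psi (h, i), t).
  by rewrite /G join_tupleK.
exists F; split; last by move=> x i; rewrite tnth_lshift tnth_mktuple.
exists G => [x|[y i]].
  rewrite -[x]split_tupleK; case: (split_tuple a s x) => h t.
  by rewrite FE GE -surjective_pairing phiK.
rewrite -[y]split_tupleK; case: (split_tuple s b y) => t h.
by rewrite GE FE psiK.
Qed.

(** Mirror image of [bijection_right], for the edges that start from the second cube. *)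
Lemma bijection_left a s b (phi : b.-tuple int -> a.-tuple int * 'I_4) :
  bijective phi ->
  exists Phi : (s + b).-tuple int -> (a + s).-tuple int * 'I_4,
    bijective Phi /\
    forall x (i : 'I_s), tnth (Phi x).1 (rshift a i) = tnth x (lshift b i).
Proof.
move=> [psi phiK psiK].
pose F x := let: (t, h) := split_tuple s b x in
  (join_tuple a s ((phi h).1, t), (phi h).2).
pose G y := let: (h, t) := split_tuple a s y.1 in
  join_tuple s b (t, psi (h, y.2)).
have FE t h : F (join_tuple s b (t, h)) = (join_tuple a s ((phi h).1, t), (phi h).2).
  by rewrite /F join_tupleK.
have GE h t i : G (join_tuple a s (h, t), i) = join_tuple s b (t, psi (h, i)).
  by rewrite /G join_tupleK.
exists F; split; last by move=> x i; rewrite tnth_rshift tnth_mktuple.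
exists G => [x|[y i]].
  rewrite -[x]split_tupleK; case: (split_tuple s b x) => t h.
  by rewrite FE GE -surjective_pairing phiK.
rewrite -[y]split_tupleK; case: (split_tuple a s y) => h t.
by rewrite GE FE psiK.
Qed.

End bijections.

(** * The measure on the union of two cubes *)

Section two_cubes.
Context {R : realType} (d k j : nat).
Hypotheses (kd : (k <= d)%N) (jd : (j <= d)%N).

Definition zreal (l : d.-tuple int) : d.-tuple R := [tuple (tnth l i)%:~R | i < d].
Definition first_freq (l : d.-tuple int) : k.-tuple int := [tuple nth 0 l i | i < k].
Definition last_freq (l : d.-tuple int) : j.-tuple int :=
  [tuple nth 0 l (i + (d - j)) | i < j].

Lemma measurable_embed_first : measurable_fun setT (embed_first R d k).
Proof.
apply/measurable_fun_tnthP => i.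
have -> : (fun t => tnth t i) \o embed_first R d k =
    fun x : k.-tuple R => if (i < k)%N then nth 0 x i else 0.
  by apply/funext => x /=; rewrite tnth_mktuple.
have [ik|ik] := boolP (i < k)%N; last exact: measurable_cst.
have -> : (fun x : k.-tuple R => nth 0 x i) = (fun x => tnth x (Ordinal ik)).
  by apply/funext => x; rewrite (tnth_nth 0).
exact: measurable_tnth.
Qed.

Lemma measurable_embed_last : measurable_fun setT (embed_last R d j).
Proof.
apply/measurable_fun_tnthP => i.
have -> : (fun t => tnth t i) \o embed_last R d j = fun x : j.-tuple R =>
    if (d - j <= i)%N then nth 0 x (i - (d - j)) else 0.
  by apply/funext => x /=; rewrite tnth_mktuple.
have [ik|ik] := boolP (d - j <= i)%N; last exact: measurable_cst.
have ij : (i - (d - j) < j)%N by rewrite ltn_subLR// subnK.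
have -> : (fun x : j.-tuple R => nth 0 x (i - (d - j))) = (fun x => tnth x (Ordinal ij)).
  by apply/funext => x; rewrite (tnth_nth 0).
exact: measurable_tnth.
Qed.

Lemma dot_embed_first l x :
  dotR R d (zreal l) (embed_first R d k x) = zdot k (first_freq l) x.
Proof.
pose F i : R := (nth 0 l i)%:~R * nth 0 x i.
transitivity (\sum_(i < k) F i); last first.
  by apply: eq_bigr => i _; rewrite tnth_mktuple (tnth_nth 0 x).
rewrite (big_ord_widen d F kd) big_mkcond; apply: eq_bigr => i _.
by rewrite !tnth_mktuple; case: ifPn => ik; rewrite ?mulr0// /F -tnth_nth.
Qed.

Lemma dot_embed_last l y :
  dotR R d (zreal l) (embed_last R d j y) = zdot j (last_freq l) y.
Proof.
pose F i : R := (nth 0 l i)%:~R * (if (d - j <= i)%N then nth 0 y (i - (d - j)) else 0).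
transitivity (\sum_(0 <= i < d) F i).
  rewrite big_mkord; apply: eq_bigr => i _.
  by rewrite !tnth_mktuple /F -tnth_nth.
rewrite (@big_cat_nat _ _ _ (d - j)%N)//= ?leq_subr//.
rewrite big_nat big1 ?add0r; last first.
  by move=> i /andP[_ id]; rewrite /F leqNgt id mulr0.
rewrite -{1}(add0n (d - j)%N) big_addn subKn// big_mkord; apply: eq_bigr => i _.
by rewrite /F leq_addl addnK tnth_mktuple (tnth_nth 0 y).
Qed.

Variables (P : probability (k.-tuple R) R) (Q : probability (j.-tuple R) R).
Hypothesis PE : forall A, measurable A -> P A = cube_measure R k A.
Hypothesis QE : forall A, measurable A -> Q A = cube_measure R j A.

Let E1 : {mfun k.-tuple R >-> d.-tuple R} := mfun_Sub (mem_set measurable_embed_first).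
Let E2 : {mfun j.-tuple R >-> d.-tuple R} := mfun_Sub (mem_set measurable_embed_last).

(** Replaces the bare set function by a genuine measure with the same values on measurable sets, to
    which the theorems on integrals apply. *)
Lemma integral_mu_kj f : integral (mu_kj R d k j) setT f =
  integral (measure_add (distribution P E1) (distribution Q E2)) setT f.
Proof.
apply: eq_integral_set_function => A mA.
rewrite measure_addE /mu_kj; congr (_ + _)%E; apply/esym.
- apply: PE; rewrite -[X in measurable X]setTI; exact: measurable_embed_first.
- apply: QE; rewrite -[X in measurable X]setTI; exact: measurable_embed_last.
Qed.

Lemma ge0_integral_mu_kj (f : d.-tuple R -> \bar R) :
  measurable_fun setT f -> (forall x, 0 <= f x)%E ->
  (\int[mu_kj R d k j]_x f x = \int[P]_x f (embed_first R d k x) +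
                               \int[Q]_x f (embed_last R d j x))%E.
Proof.
move=> mf f0; rewrite integral_mu_kj ge0_integral_measure_add//.
rewrite (ge0_integral_pushforward measurable_embed_first)// ?preimage_setT//.
by rewrite (ge0_integral_pushforward measurable_embed_last)// preimage_setT.
Qed.

Lemma Rintegral_mu_kj (g : d.-tuple R -> R) : measurable_fun setT g ->
  P.-integrable setT (EFin \o (fun x => g (embed_first R d k x))) ->
  Q.-integrable setT (EFin \o (fun x => g (embed_last R d j x))) ->
  fine (\int[mu_kj R d k j]_x (g x)%:E)%E =
  \int[P]_x g (embed_first R d k x) + \int[Q]_x g (embed_last R d j x).
Proof.
move=> mg i1 i2.
have meg : measurable_fun setT (EFin \o g) by exact/measurable_EFinP.
have j1 : (distribution P E1).-integrable setT (EFin \o g).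
  by apply: integrable_pushforward => //; exact: measurable_embed_first.
have j2 : (distribution Q E2).-integrable setT (EFin \o g).
  by apply: integrable_pushforward => //; exact: measurable_embed_last.
rewrite integral_mu_kj integral_measure_add//.
rewrite (integral_pushforward measurable_embed_first)// ?preimage_setT//.
rewrite (integral_pushforward measurable_embed_last)// ?preimage_setT//.
by rewrite fineD//; exact: integrable_fin_num.
Qed.

Variable f : d.-tuple R -> R[i].
Hypothesis fL2 : L2 R d (mu_kj R d k j) f.

Definition re1 x := complex.Re (f (embed_first R d k x)).
Definition im1 x := complex.Im (f (embed_first R d k x)).
Definition re2 x := complex.Re (f (embed_last R d j x)).
Definition im2 x := complex.Im (f (embed_last R d j x)).

Lemma L2_sqint : [/\ sqint P re1, sqint P im1, sqint Q re2 & sqint Q im2].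
Proof.
have [mre [mim]] := fL2.
have mre1 : measurable_fun setT re1 := measurableT_comp mre measurable_embed_first.
have mim1 : measurable_fun setT im1 := measurableT_comp mim measurable_embed_first.
have mre2 : measurable_fun setT re2 := measurableT_comp mre measurable_embed_last.
have mim2 : measurable_fun setT im2 := measurableT_comp mim measurable_embed_last.
rewrite ge0_integral_mu_kj; first last.
- by move=> x; rewrite lee_fin addr_ge0 ?sqr_ge0.
- by apply/measurable_EFinP; apply: measurable_funD; exact: measurable_funX.
move=> fin.
have s d' (T : measurableType d') (M : probability T R) (u v w : T -> R) :
    measurable_fun setT u -> measurable_fun setT v -> measurable_fun setT w ->
    (\int[M]_x (u x ^+ 2 + v x ^+ 2)%:E < +oo)%E ->
    (forall x, w x ^+ 2 <= u x ^+ 2 + v x ^+ 2) -> sqint M w.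
  move=> mu mv mw H wuv; split => //; apply/integrableP; split.
    by apply/measurable_EFinP; exact: measurable_funX.
  apply: le_lt_trans H; apply: ge0_le_integral => //.
  - by apply/measurable_EFinP; apply: measurableT_comp => //; exact: measurable_funX.
  - by apply/measurable_EFinP; apply: measurable_funD; exact: measurable_funX.
  - by move=> x _ /=; rewrite lee_fin ger0_norm ?sqr_ge0.
have fin1 : (\int[P]_x (re1 x ^+ 2 + im1 x ^+ 2)%:E < +oo)%E.
  apply: le_lt_trans fin; rewrite leeDl// integral_ge0// => x _.
  by rewrite lee_fin addr_ge0 ?sqr_ge0.
have fin2 : (\int[Q]_x (re2 x ^+ 2 + im2 x ^+ 2)%:E < +oo)%E.
  apply: le_lt_trans fin; rewrite leeDr// integral_ge0// => x _.
  by rewrite lee_fin addr_ge0 ?sqr_ge0.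
by split; [apply: (s _ _ P re1 im1)|apply: (s _ _ P re1 im1)|
  apply: (s _ _ Q re2 im2)|apply: (s _ _ Q re2 im2)] => // x;
  rewrite ?lerDl ?lerDr sqr_ge0.
Qed.

Lemma L2norm2_mu_kj : L2norm2 R d (mu_kj R d k j) f =
  ((ip P re1 re1 + ip P im1 im1) + (ip Q re2 re2 + ip Q im2 im2))%:E.
Proof.
have [mre [mim _]] := fL2; have [s1 s2 s3 s4] := L2_sqint.
rewrite /L2norm2 ge0_integral_mu_kj; first last.
- by move=> x; rewrite lee_fin addr_ge0 ?sqr_ge0.
- by apply/measurable_EFinP; apply: measurable_funD; exact: measurable_funX.
have ipE d' (T : measurableType d') (M : probability T R) (u v : T -> R) :
    sqint M u -> sqint M v ->
    (\int[M]_x (u x ^+ 2 + v x ^+ 2)%:E)%E = (ip M u u + ip M v v)%:E.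
  move=> su sv; rewrite /ip -RintegralD//; [|exact: sqint_mul..].
  rewrite /Rintegral fineK; last first.
    apply: integrable_fin_num => //.
    apply: eq_integrable (integrableD measurableT
      (sqint_mul _ _ _ su su) (sqint_mul _ _ _ sv sv)) => //.
  by apply: eq_integral => x _; rewrite !expr2.
by rewrite EFinD -!ipE.
Qed.

(** On each cube the exponential depends on the first or last entries of [l] only. The two brackets
    are the real and imaginary parts of the sum of the two Fourier coefficients, the form of [N] in
    the edge sums. *)
Lemma L2inner_mu_kj (l : d.-tuple int) :
  sqnormC R (L2inner R d (mu_kj R d k j) f (expo R d (zreal l))) =
  ((ip P re1 (zcos k (first_freq l)) + ip P im1 (zsin k (first_freq l))) +
   (ip Q re2 (zcos j (last_freq l)) + ip Q im2 (zsin j (last_freq l)))) ^+ 2 +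
  ((ip P im1 (zcos k (first_freq l)) - ip P re1 (zsin k (first_freq l))) +
   (ip Q im2 (zcos j (last_freq l)) - ip Q re2 (zsin j (last_freq l)))) ^+ 2.
Proof.
have [mre [mim _]] := fL2; have [s1 s2 s3 s4] := L2_sqint.
pose th x : R := 2 * pi * dotR R d (zreal l) x.
pose u x := complex.Re (f x); pose v x := complex.Im (f x).
have reE x : complex.Re (f x * (expo R d (zreal l) x)^*)%C =
      u x * cos (th x) + v x * sin (th x).
  by rewrite /u /v /expo; case: (f x) => p q /=; rewrite -/(th x); ring.
have imE x : complex.Im (f x * (expo R d (zreal l) x)^*)%C =
      v x * cos (th x) - u x * sin (th x).
  by rewrite /u /v /expo; case: (f x) => p q /=; rewrite -/(th x); ring.
have th1 x : th (embed_first R d k x) = 2 * pi * zdot k (first_freq l) x.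
  by rewrite /th dot_embed_first.
have th2 x : th (embed_last R d j x) = 2 * pi * zdot j (last_freq l) x.
  by rewrite /th dot_embed_last.
have mth : measurable_fun setT th.
  apply: measurable_funM => //; apply: measurable_sum => i.
  by apply: measurable_funM => //; exact: measurable_tnth.
have mcos : measurable_fun setT (fun x => cos (th x)).
  apply: measurableT_comp mth; apply: continuous_measurable_fun; exact: continuous_cos.
have msin : measurable_fun setT (fun x => sin (th x)).
  apply: measurableT_comp mth; apply: continuous_measurable_fun; exact: continuous_sin.
have comb d' (T : measurableType d') (M : probability T R) (p q r s : T -> R) :
    sqint M p -> sqint M q -> sqint M r -> sqint M s ->
    M.-integrable setT (EFin \o (fun x => p x * q x + r x * s x)) /\
    M.-integrable setT (EFin \o (fun x => p x * q x - r x * s x)).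
  move=> sp sq sr ss; split.
    apply: eq_integrable (integrableD measurableT
      (sqint_mul _ _ _ sp sq) (sqint_mul _ _ _ sr ss)) => //.
  apply: eq_integrable (integrableB measurableT
    (sqint_mul _ _ _ sp sq) (sqint_mul _ _ _ sr ss)) => //.
have c1 := sqint_zcos k P (first_freq l); have z1 := sqint_zsin k P (first_freq l).
have c2 := sqint_zcos j Q (last_freq l); have z2 := sqint_zsin j Q (last_freq l).
have [a1 _] := comb _ _ P _ _ _ _ s1 c1 s2 z1.
have [_ b1] := comb _ _ P _ _ _ _ s2 c1 s1 z1.
have [a2 _] := comb _ _ Q _ _ _ _ s3 c2 s4 z2.
have [_ b2] := comb _ _ Q _ _ _ _ s4 c2 s3 z2.
rewrite /sqnormC /L2inner /Cintegral.
have -> : (fun x => (complex.Re (f x * (expo R d (zreal l) x)^*)%C)%:E) =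
    (fun x => (u x * cos (th x) + v x * sin (th x))%:E).
  by apply/funext => x; rewrite reE.
have -> : (fun x => (complex.Im (f x * (expo R d (zreal l) x)^*)%C)%:E) =
    (fun x => (v x * cos (th x) - u x * sin (th x))%:E).
  by apply/funext => x; rewrite imE.
rewrite (Rintegral_mu_kj (fun x => u x * cos (th x) + v x * sin (th x))); first last.
- by under eq_fun do rewrite th2.
- by under eq_fun do rewrite th1.
- by apply: measurable_funD; exact: measurable_funM.
rewrite (Rintegral_mu_kj (fun x => v x * cos (th x) - u x * sin (th x))); first last.
- by under eq_fun do rewrite th2.
- by under eq_fun do rewrite th1.
- by apply: measurable_funB; exact: measurable_funM.
have ReC (p q : R) : complex.Re (p%:C%C + 'i%C * q%:C%C) = p by rewrite /=; ring.
have ImC (p q : R) : complex.Im (p%:C%C + 'i%C * q%:C%C) = q by rewrite /=; ring.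
rewrite ReC ImC /ip -!RintegralD//; try exact: sqint_mul.
rewrite -!RintegralB//; try exact: sqint_mul.
by congr ((_ + _) ^+ 2 + (_ + _) ^+ 2); apply: eq_Rintegral => x _;
  rewrite ?th1 ?th2.
Qed.

End two_cubes.

(** * Frequencies with prescribed first and last entries *)

Section gluing.
Variables (a s b d : nat).
Hypotheses (abd : (a + s + b <= d)%N) (overlap : (0 < s)%N -> d = (a + s + b)%N).

(* Entries strictly between the first a + s and the last s + b positions are junk,
   read neither by [first_freq] nor by [last_freq]. *)
Definition glue_freq (x : (a + s).-tuple int) (y : (s + b).-tuple int) : d.-tuple int :=
  [tuple if (i < a + s)%N then nth 0 x i else nth 0 y (i - (d - (s + b))) | i < d].

Lemma nth_glue_freq x y i : (i < d)%N -> nth 0 (glue_freq x y) i =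
  if (i < a + s)%N then nth 0 x i else nth 0 y (i - (d - (s + b))).
Proof. by move=> id; rewrite -(tnth_nth 0 _ (Ordinal id)) tnth_mktuple. Qed.

Lemma first_freq_glue_freq x y : first_freq d (a + s) (glue_freq x y) = x.
Proof.
apply: eq_from_tnth => i; rewrite tnth_mktuple nth_glue_freq ?ltn_ord -?tnth_nth//.
by apply: leq_trans (ltn_ord i) _; lia.
Qed.

(** Positions common to both blocks are filled from [x], and the hypothesis makes [y] agree
    there. *)
Lemma last_freq_glue_freq x y :
  (forall i : 'I_s, tnth y (lshift b i) = tnth x (rshift a i)) ->
  last_freq d (s + b) (glue_freq x y) = y.
Proof.
move=> xy; apply: eq_from_tnth => i; have ib := ltn_ord i.
rewrite tnth_mktuple nth_glue_freq; last by lia.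
rewrite addnK -tnth_nth; case: ifPn => // h.
(* For [s = 0] the blocks are disjoint, contradicting [h]. Otherwise [overlap] makes the second
   block start at position [a]. *)
have [s0|s0] := posnP s; first by lia.
have dE := overlap s0; have si : (i < s)%N by lia.
have := xy (Ordinal si); rewrite !(tnth_nth 0)/= => ->.
by congr nth; lia.
Qed.

End gluing.

Lemma zreal_inj (R : realType) d : injective (@zreal R d).
Proof.
move=> x y xy; apply: eq_from_tnth => i.
have := congr1 (fun t => tnth t i) xy; rewrite !tnth_mktuple.
by move/eqP; rewrite eqr_int => /eqP.
Qed.

(** * The frame and its bounds *)

Lemma two_cubes_frame (R : realType) (a s b d : nat) :
  (0 < a)%N -> (0 < b)%N -> (a + s + b <= d)%N ->
  ((0 < s)%N -> d = (a + s + b)%N) ->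
  admits_fourier_frame R d (mu_kj R d (a + s) (s + b)).
Proof.
move=> a0 b0 abd overlap.
have [P [PE Pm Pc]] := @cube_probability R (a + s).
have [Q [QE Qm Qc]] := @cube_probability R (s + b).
have [phi bphi] := bijection_fiber4 _ _ a0 b0.
have [psi bpsi] := bijection_fiber4 _ _ b0 a0.
have [Phi [bPhi cPhi]] := bijection_right a s b phi bphi.
have [Psi [bPsi cPsi]] := bijection_left a s b psi bpsi.
pose edgeX x := glue_freq a s b d x (Phi x).1.
pose edgeY y := glue_freq a s b d (Psi y).1 y.
have f1 x : first_freq d (a + s) (edgeX x) = x by exact: first_freq_glue_freq.
have l1 x : last_freq d (s + b) (edgeX x) = (Phi x).1 by exact: last_freq_glue_freq.
have f2 y : first_freq d (a + s) (edgeY y) = (Psi y).1 by exact: first_freq_glue_freq.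
have l2 y : last_freq d (s + b) (edgeY y) = y by apply: last_freq_glue_freq => // i; rewrite cPsi.
pose S1 := range (fun x => @zreal R d (edgeX x)).
pose S2 := range (fun y => @zreal R d (edgeY y)).
exists (S1 `|` S2); split.
  apply: (@sub_countable _ _ _ (range (@zreal R d))).
    by apply: subset_card_le => _ [[x _ <-]|[y _ <-]]; [exists (edgeX x)|exists (edgeY y)].
  exact: (card_le_trans (card_image_le _ _) (countableP _)).
have kd : (a + s <= d)%N by lia.
have jd : (s + b <= d)%N by lia.
(* The lower bounds [2 * SY - SX] and [2 * SX - SY] add up to [SX + SY]. As [S1] and [S2] may
   intersect, each sum is compared separately with the sum over the union, which costs the factor
   1/2. The upper bounds add up to [(2 + 8) * (SX + SY)]. *)
exists 2^-1, 10; split; first by rewrite invr_gt0.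
split => // f fL2.
pose G lam := (sqnormC R (L2inner R d (mu_kj R d (a + s) (s + b)) f (expo R d lam)))%:E.
have G0 lam : (0 <= G lam)%E by rewrite lee_fin addr_ge0 ?sqr_ge0.
have [sre1 sim1 sre2 sim2] := L2_sqint d (a + s) (s + b) jd P Q PE QE f fL2.
have hX := parseval_fourier _ _ Pm Pc _ _ sre1 sim1.
have hY := parseval_fourier _ _ Qm Qc _ _ sre2 sim2.
rewrite (L2norm2_mu_kj d (a + s) (s + b) jd P Q PE QE f fL2).
set SX := ip _ _ _ + ip _ _ _ in hX *.
set SY := ip _ _ _ + ip _ _ _ in hY *.
have E1 : \esum_(lam in S1) G lam =
    \esum_(x in [set: (a + s).-tuple int]) G (zreal d (edgeX x)).
  apply: esum_image => x y _ _ /zreal_inj/(congr1 (first_freq d (a + s))).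
  by rewrite !f1.
have E2 : \esum_(lam in S2) G lam =
    \esum_(y in [set: (s + b).-tuple int]) G (zreal d (edgeY y)).
  apply: esum_image => x y _ _ /zreal_inj/(congr1 (last_freq d (s + b))).
  by rewrite !l2.
have GE := L2inner_mu_kj d (a + s) (s + b) kd jd P Q PE QE f fL2.
have := edge_sum_lower _ _ _ _ _ _ _ _ hX hY _ bPhi.
have := edge_sum_upper _ _ _ _ _ _ _ _ hX hY _ bPhi.
set U := esum _ _; have -> : U = \esum_(lam in S1) G lam.
  by rewrite E1; apply: eq_esum => x _; rewrite /G GE f1 l1.
move=> U1 V1.
have := edge_sum_lower _ _ _ _ _ _ _ _ hY hX _ bPsi.
have := edge_sum_upper _ _ _ _ _ _ _ _ hY hX _ bPsi.
set V := esum _ _; have -> : V = \esum_(lam in S2) G lam.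
  rewrite E2; apply: eq_esum => y _; rewrite /G GE f2 l2.
  by congr (_ ^+ 2 + _ ^+ 2)%:E; rewrite addrC.
move=> U2 V2; split.
  have W1 : (\esum_(lam in S1) G lam <= \esum_(lam in S1 `|` S2) G lam)%E.
    exact: subset_esum.
  have W2 : (\esum_(lam in S2) G lam <= \esum_(lam in S1 `|` S2) G lam)%E.
    exact: subset_esum.
  move: (le_trans V1 W1) (le_trans V2 W2); rewrite -/G.
  case: (esum _ _) => [r| |]//; last by move=> _ _; rewrite leey.
  by rewrite -EFinM !lee_fin; lra.
apply: le_trans (esum_setU _ S1 S2 G G0) _.
apply: le_trans (leeD U1 U2) _.
by rewrite -EFinD -EFinM lee_fin; lra.
Qed.

Theorem theorem2p2 (R : realType) (d j k : nat) :
  (2 <= d)%N -> (1 <= j <= d - 1)%N -> (1 <= k <= d - 1)%N ->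
  admits_fourier_frame R d (mu_kj R d k j).
Proof.
(* With truncated subtraction [s] counts the coordinates common to both cubes. Then [k - s] and
   [j - s] are positive since [k] and [j] are less than [d], and the blocks fill all [d] positions
   when [s] is positive. *)
move=> d2 j1 k1; pose s := (k + j - d)%N.
have -> : k = (k - s + s)%N by rewrite /s; lia.
have -> : mu_kj R d (k - s + s) j = mu_kj R d (k - s + s) (s + (j - s)).
  by congr mu_kj; rewrite /s; lia.
by apply: two_cubes_frame; rewrite /s; lia.
Qed.
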